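(* Let $d\in\mathbb{N}$, let $\Omega\subseteq\mathbb{R}^d$ be a compact convex subset with dense interior (for example $\Omega=[0,1]^d$), and fix a norm on $\mathbb{R}^d$. Let the integers $M_k$ be defined by $M_0:=M_1:=1$ and $$M_k:=\sum_{j=2}^k\ \sum_{\{I_1,\dots,I_j\}\in P_{k,j}}M_{|I_1|}\cdots M_{|I_j|}\qquad\text{for } k\geq 2,$$ where $P_{k,j}$ is the set of all partitions of $\{1,\dots,k\}$ into $j$ disjoint non-empty subsets $I_1,\dots,I_j$. Then for all $k\in\mathbb{N}_0$ and all $L\in\mathbb{N}$, $$\|((\operatorname{id}_\Omega+f_L)\circ\cdots\circ(\operatorname{id}_\Omega+f_1))-\operatorname{id}_\Omega\|_{C^k}\ \leq\ M_k\,e^{k\sum_{j=1}^L\|f_j\|_{C^k}}\,(\|f_1\|_{C^k}+\cdots+\|f_L\|_{C^k})$$ holds for all $f_1,\dots,f_L\in\operatorname{Diff}_\partial(\Omega)-\operatorname{id}_\Omega$ such that $\|f_1\|_{C^k}+\cdots+\|f_L\|_{C^k}\leq 1$. Notably, for all such $f_1,\dots,f_L$, $$\|((\operatorname{id}_\Omega+f_L)\circ\cdots\circ(\operatorname{id}_\Omega+f_1))-\operatorname{id}_\Omega\|_{C^k}\ \leq\ M_k\,e^{k}\,(\|f_1\|_{C^k}+\cdots+\|f_L\|_{C^k}).$$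
   Context: $\Omega\subseteq\mathbb{R}^d$ has dense interior if the interior $\Omega^\circ$ is dense in $\Omega$. A map on $\Omega$ is smooth ($C^\infty$) if it extends to a smooth map on an open subset of $\mathbb{R}^d$ containing $\Omega$. $\operatorname{Diff}(\Omega)$ is the group of all $C^\infty$-diffeomorphisms of $\Omega$ (bijections of $\Omega$, smooth with smooth inverse), and $$\operatorname{Diff}_\partial(\Omega):=\{\phi\in\operatorname{Diff}(\Omega) : \phi(k)=k\ \text{for all } k\in\partial\Omega\},$$ with $\partial\Omega$ the topological boundary. $\operatorname{Diff}_\partial(\Omega)-\operatorname{id}_\Omega:=\{\phi-\operatorname{id}_\Omega : \phi\in\operatorname{Diff}_\partial(\Omega)\}$; its elements are smooth maps $\Omega\to\mathbb{R}^d$ vanishing on $\partial\Omega$. Write $E:=\mathbb{R}^d$ with the fixed norm $\|\cdot\|$. For a $k$-linear map $\beta\colon E^k\to E$, put $\|\beta\|_{\mathrm{op}}:=\sup\{\|\beta(x_1,\dots,x_k)\| : \|x_1\|,\dots,\|x_k\|\leq 1\}$. For $f\in C^\infty(\Omega,E)$, $k\in\mathbb{N}$ and $x\in\Omega$, let $f^{(k)}(x)\colon E^k\to E$ be the $k$-th derivative, i.e. $f^{(k)}(x)(y_1,\dots,y_k)=(D_{y_k}\cdots D_{y_1}f)(x)$ for $x\in\Omega^\circ$, extended continuously to $x\in\Omega$. Put $\|f^{(k)}\|_{\infty,\mathrm{op}}:=\sup_{x\in\Omega}\|f^{(k)}(x)\|_{\mathrm{op}}$ and $\|f\|_\infty:=\sup_{x\in\Omega}\|f(x)\|$.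 Then $\|f\|_{C^0}:=\|f\|_\infty$ and, for $k\in\mathbb{N}$, $$\|f\|_{C^k}:=\max\{\|f\|_\infty,\|f^{(1)}\|_{\infty,\mathrm{op}},\dots,\|f^{(k)}\|_{\infty,\mathrm{op}}\}.$$ $\mathbb{N}=\{1,2,\dots\}$ and $\mathbb{N}_0=\mathbb{N}\cup\{0\}$. *)

(* Defs.v *)
From HB Require Import structures.
From mathcomp Require Import all_boot all_order all_algebra.

Set Implicit Arguments.
Unset Strict Implicit.
Unset Printing Implicit Defensive.

(* Course-of-values recursion for M_k, with fuel n; the value does not depend
   on the fuel as soon as k <= n, see Mcoef_rec. *)
Fixpoint Mfuel (n k : nat) : nat :=
  if n isn't n'.+1 then 1 else
  if k <= 1 then 1 else
  \sum_(2 <= j < k.+1)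
    \sum_(P : {set {set 'I_k}} | partition P [set: 'I_k] && (#|P| == j))
      \prod_(I in P) Mfuel n' #|I|.

Definition Mcoef (k : nat) : nat := Mfuel k k.

Lemma partition_block_lt (k : nat) (P : {set {set 'I_k}}) (I : {set 'I_k}) :
  partition P [set: 'I_k] -> 1 < #|P| -> I \in P -> #|I| < k.
Proof.
move=> partP P1 IP.
have /and3P[_ _ P0] := partP.
suff : #|I| < \sum_(J in P) #|J|.
  by rewrite -(card_partition partP) cardsT card_ord.
have : 0 < #|P :\ I| by move: P1; rewrite (cardsD1 I) IP.
case/card_gt0P => J /[!inE] /andP[JI JP].
rewrite (bigD1 I)//= (bigD1 J) ?JP//= -[ltnLHS]addn0 ltn_add2l addn_gt0.
apply/orP; left; rewrite lt0n cards_eq0.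
by apply: contraNneq P0 => <-.
Qed.

Lemma Mfuel_stable (n m k : nat) : k <= n -> k <= m -> Mfuel n k = Mfuel m k.
Proof.
elim: n m k => [|n IHn] [|m] k //=; first by move=> k0 _; rewrite (leq_trans k0).
  by move=> _ k0; rewrite (leq_trans k0).
move=> kn km; case: leqP => // k1.
apply: eq_big_nat => j /andP[j2 _]; apply: eq_bigr => P /andP[partP /eqP Pj].
apply: eq_bigr => I IP.
have Ik : #|I| < k by apply: partition_block_lt IP; rewrite ?Pj.
by apply: IHn; rewrite -ltnS; exact: leq_trans Ik _.
Qed.

Lemma Mcoef0 : Mcoef 0 = 1. Proof. by []. Qed.

Lemma Mcoef1 : Mcoef 1 = 1. Proof. by []. Qed.

Lemma Mcoef_rec (k : nat) : 2 <= k ->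
  Mcoef k = \sum_(2 <= j < k.+1)
    \sum_(P : {set {set 'I_k}} | partition P [set: 'I_k] && (#|P| == j))
      \prod_(I in P) Mcoef #|I|.
Proof.
case: k => // k k2; rewrite {1}/Mcoef [LHS]/= [k.+1 <= 1]leqNgt k2 /=.
apply: eq_big_nat => j /andP[j2 _]; apply: eq_bigr => P /andP[partP /eqP Pj].
apply: eq_bigr => I IP; apply: Mfuel_stable => //.
by rewrite -ltnS; apply: partition_block_lt IP; rewrite ?Pj.
Qed.

From mathcomp Require Import all_classical all_reals all_analysis.

Import Order.TTheory GRing.Theory Num.Theory.
Import numFieldNormedType.Exports.

Local Open Scope classical_set_scope.
Local Open Scope ring_scope.

Section Defs.
Context {R : realType} {d : nat}.
Local Notation E := 'rV[R]_d.
Implicit Types (N : E -> R) (Omega U : set E) (f g phi psi : E -> E).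

(* The norm of the library on 'rV_d is the sup norm; here the norm is arbitrary.
   The topologies agree, so only the quantitative notions mention N. *)
Definition is_norm N : Prop :=
  [/\ forall x, N x = 0 -> x = 0,
      forall (a : R) x, N (a *: x) = `|a| * N x &
      forall x y, N (x + y) <= N x + N y].

Definition dense_interior Omega : Prop := Omega `<=` closure Omega°.

Definition boundary Omega : set E := closure Omega `\` Omega°.

(* iterD f [:: y_1; ...; y_k] is D_{y_k} ... D_{y_1} f *)
Definition iterD f (ys : seq E) : E -> E := foldl (fun g y => 'D_y g) f ys.

(* All iterated directional derivatives exist and are continuous on U; meant
   for open U, where only the values of g on U matter. *)
Definition smooth_open U g : Prop :=
  forall (ys : seq E) (x : E), U x ->
    {for x, continuous (iterD g ys)} /\
    (forall v, derivable (iterD g ys) x v).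

(* A map on Omega is represented by a total function of which only the values
   on Omega matter. *)
Definition smooth Omega f : Prop :=
  exists U g, [/\ open U, Omega `<=` U, smooth_open U g &
                  forall x, Omega x -> f x = g x].

Definition Diff Omega : set (E -> E) :=
  [set phi | [/\ set_bij Omega Omega phi, smooth Omega phi &
     exists2 psi, smooth Omega psi & forall x, Omega x -> psi (phi x) = x]].

Definition Diff_bd Omega : set (E -> E) :=
  [set phi | Diff Omega phi /\ forall x, boundary Omega x -> phi x = x].

Definition Diff_bd_sub_id Omega : set (E -> E) :=
  [set f | exists2 phi, Diff_bd Omega phi &
     forall x, Omega x -> f x = phi x - x].

(* f^(k)(x), extended to the boundary by its limit from the interior *)
Definition derivk Omega (k : nat) f (x : E) (ys : k.-tuple E) : E :=
  if `[< Omega° x >] then iterD f ys x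
  else lim (iterD f ys z @[z --> within Omega° (nbhs x)]).

(* The norms take values in [0, +oo] (or -oo for empty Omega), so that suprema
   are meaningful without a boundedness proof. *)
Local Open Scope ereal_scope.

Definition opnorm N (k : nat) (beta : k.-tuple E -> E) : \bar R :=
  ereal_sup [set (N (beta ys))%:E |
    ys in [set ys : k.-tuple E | forall i, (N (tnth ys i) <= 1)%R]].

Definition supnorm N Omega f : \bar R :=
  ereal_sup [set (N (f x))%:E | x in Omega].

Definition supopnorm N Omega (k : nat) f : \bar R :=
  ereal_sup [set opnorm N (@derivk Omega k f x) | x in Omega].

Definition Cnorm N Omega (k : nat) f : \bar R :=
  \big[maxe/supnorm N Omega f]_(1 <= i < k.+1) supopnorm N Omega i f.

Local Close Scope ereal_scope.

(* (id + f_(L-1)) \o ... \o (id + f_0) *)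
Definition comp_id_add (L : nat) (f : 'I_L -> E -> E) : E -> E :=
  foldl (fun g i => (idfun \+ f i) \o g) idfun (enum 'I_L).

End Defs.

(* Main.v *)
(** Write psi_m = (id + f_m) o ... o (id + f_1), so that
    psi_m = psi_(m-1) + f_m o psi_(m-1). By Faa di Bruno's formula the k-th
    derivative of f_m o psi_(m-1) is a sum over the partitions P of {1,...,k} of
    f_m^(|P|) applied to the derivatives psi_(m-1)^(|I|), I in P. The partition
    with one block contributes at most |f_m| |psi_(m-1)^(k)|, and the others
    only involve derivatives of order < k. With s_m = |f_1| + ... + |f_m| <= 1
    and the inductive bounds |psi_(m-1)^(i)| <= M_i e^(i s_(m-1)) for 0 < i < k,
    the recursion for M_k gives, for k >= 2,
      |psi_m^(k)| <= (1 + |f_m|) |psi_(m-1)^(k)| + |f_m| M_k e^(k s_(m-1)),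
    whence |psi_m^(k)| <= M_k e^(k s_m) s_m. The estimates are carried
    out directly at every point of Omega, boundary points included, with the
    derivatives of smooth extensions to a neighbourhood of Omega. *)

From Pilot Require Import Defs.
From HB Require Import structures.
From mathcomp Require Import all_boot all_order all_algebra.

Set Implicit Arguments.
Unset Strict Implicit.
Unset Printing Implicit Defensive.

Import Order.TTheory GRing.Theory Num.Theory.

(** * Set partitions and the blocks of iterated chain rules *)

(** The combinatorial form of the product rule: each list of the result has [g] applied at exactly
    one position. *)
Fixpoint repl (T : Type) (g : T -> T) (s : seq T) : seq (seq T) :=
  if s is x :: s' then (g x :: s') :: map (cons x) (repl g s') else [::].

Section Blocks.
Context {T : Type}.
Implicit Types (ys : seq T) (bl : seq (seq T)).

Definition add_to_block (v : T) bl : seq (seq (seq T)) :=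
  rcons bl [:: v] :: repl (rcons^~ v) bl.

(* The partitions of the list ys into blocks, in the order in which they appear
   when the chain rule is iterated: the last entry either is a new block or
   is appended to an existing one. *)
Definition faa_blocks ys : seq (seq (seq T)) :=
  foldl (fun bls v => flatten [seq add_to_block v bl | bl <- bls]) [:: [::]] ys.

Lemma faa_blocks_rcons ys v : faa_blocks (rcons ys v) =
  flatten [seq add_to_block v bl | bl <- faa_blocks ys].
Proof. by rewrite /faa_blocks -cats1 foldl_cat. Qed.

End Blocks.

Lemma map_repl (T T' : Type) (h : T -> T') (g : T -> T) (g' : T' -> T') s :
  (forall x, h (g x) = g' (h x)) ->
  [seq map h t | t <- repl g s] = repl g' (map h s).
Proof.
move=> hg; elim: s => [//|x s IH] /=; rewrite hg -IH; congr (_ :: _).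
by rewrite -!map_comp; apply: eq_map.
Qed.

Definition perm_invariant (T : eqType) (S : Type) (w : seq T -> S) :=
  forall s t, perm_eq s t -> w s = w t.

Section BlocksSums.
Context {R : nmodType}.
Local Open Scope ring_scope.

(** Invariance of [w] under permutations lets the modified entry move to the front. When entries
    repeat, [rem] may remove another copy, which changes the list only up to order. *)
Lemma sum_repl (T : eqType) (g : T -> T) (w : seq T -> R) (s : seq T) :
  perm_invariant w ->
  \sum_(t <- repl g s) w t = \sum_(x <- s) w (g x :: rem x s).
Proof.
elim: s w => [|a s IH] w w_perm; first by rewrite !big_nil.
rewrite !big_cons /= eqxx big_map; congr (_ + _).
rewrite (IH (fun t => w (a :: t))) => [|t u tu]; last first.
  by apply: w_perm; rewrite perm_cons.
rewrite !big_seq; apply: eq_bigr => x xs; apply: w_perm.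
apply: (@perm_trans _ [:: g x, a & rem x s]).
  by rewrite (perm_catCA [:: a] [:: g x]).
rewrite perm_cons; case: eqVneq => [ax|//]; rewrite -ax perm_sym; apply: perm_to_rem.
by rewrite ax.
Qed.

Lemma perm_rem_eq (T : eqType) (x : T) (s t : seq T) : x \in s -> perm_eq s t ->
  perm_eq (rem x s) (rem x t).
Proof.
move=> xs st; rewrite -(perm_cons x); apply: perm_trans (perm_to_rem _).
  by rewrite perm_sym; apply: perm_trans (perm_to_rem xs); rewrite perm_sym.
by rewrite -(perm_mem st).
Qed.

End BlocksSums.

(** * Inserting a point into a set partition and removing it *)

Section PartitionSplit.
Context {T : finType}.
Implicit Types (P Q : {set {set T}}) (A B I : {set T}).

(** With [I = set0], which is never a block of a partition, this adds the singleton block of [v];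
    letting [I] range over [set0 |: Q] thus covers both ways of inserting [v]. *)
Definition extend_block (v : T) Q I : {set {set T}} := (v |: I) |: (Q :\ I).

(** Undoes [extend_block]; the block of [v] is discarded when it contains nothing else, so that no
    empty block arises. *)
Definition drop_point (v : T) P : {set {set T}} :=
  let J := pblock P v in
  if J :\ v == set0 then P :\ J else (J :\ v) |: (P :\ J).

Lemma setD1_notin (S : finType) (x : S) (A : {set S}) : x \notin A -> A :\ x = A.
Proof. by move=> xA; apply/setDidPl; rewrite disjoint_sym disjoints1. Qed.

Lemma notin_block v B Q I : v \notin B -> partition Q B -> I \in set0 |: Q ->
  v \notin I.
Proof.
move=> vB partQ; case/setU1P => [->|IQ]; first by rewrite inE.
by apply: contra vB; exact/subsetP/(partitionS partQ).
Qed.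

Lemma partition_extend v B Q I : v \notin B -> partition Q B ->
  I \in set0 |: Q -> partition (extend_block v Q I) (v |: B).
Proof.
move=> vB partQ I0Q.
have [partQI ->] : partition (Q :\ I) (B :\: I) /\ v |: B = (v |: I) :|: (B :\: I).
  case/setU1P: I0Q => [->|IQ].
    by rewrite setD1_notin ?(partition0 partQ)// setD0 setU0.
  split; first exact: partitionD1.
  apply/setP => x; rewrite !inE; have [xI|xI] := boolP (x \in I); last by rewrite orbF.
    by rewrite (subsetP (partitionS partQ IQ) x xI) /= !orbT.
rewrite /extend_block; apply: partitionU1 => //.
  by apply/set0Pn; exists v; rewrite setU11.
rewrite -setI_eq0; apply/eqP/setP => x; rewrite !inE.
have [->|_] := eqVneq x v; first by rewrite (negbTE vB) andbF.
by case: (x \in I).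
Qed.

Lemma drop_extend v B Q I : v \notin B -> partition Q B ->
  I \in set0 |: Q -> drop_point v (extend_block v Q I) = Q.
Proof.
move=> vB partQ I0Q; have vI := notin_block vB partQ I0Q.
have part := partition_extend vB partQ I0Q.
have EJ : pblock (extend_block v Q I) v = v |: I.
  by apply: (def_pblock (partition_trivIset part)); rewrite setU11.
rewrite /drop_point EJ setU1K// setU1K; last first.
  rewrite inE negb_and orbC; apply/orP; left; apply/negP => vIQ.
  have /(notin_block vB partQ) : v |: I \in set0 |: Q by rewrite inE vIQ orbT.
  by rewrite setU11.
case: eqVneq => [->|I0]; first by rewrite setD1_notin// (partition0 partQ).
by case/setU1P: I0Q => [I0'|IQ]; [rewrite I0' eqxx in I0|rewrite setD1K].
Qed.

(** The witness is the block of [v] without [v], which is empty exactly when [v] forms a block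
    alone. *)
Lemma partition_drop v B P : v \notin B -> partition P (v |: B) ->
  partition (drop_point v P) B /\
  exists2 I, I \in set0 |: drop_point v P & P = extend_block v (drop_point v P) I.
Proof.
move=> vB partP; rewrite /drop_point; set J := pblock P v.
have vP : v \in cover P by rewrite (cover_partition partP) setU11.
have JP : J \in P by exact: pblock_mem.
have vJ : v \in J by rewrite mem_pblock.
have partJ := partitionD1 partP JP.
have BJ : B = (J :\ v) :|: ((v |: B) :\: J).
  have /subsetP JB := partitionS partP JP.
  apply/setP => x; rewrite !inE; have [->|xv] := eqVneq x v.
    by rewrite (negbTE vB) vJ.
  have [xJ|//] := boolP (x \in J).
  by have := JB x xJ; rewrite !inE (negbTE xv).
case: eqVneq => [J0|J0].
  have JE : J = [set v] by rewrite -(setD1K vJ) J0 setU0.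
  split; first by rewrite [B]BJ J0 set0U.
  exists set0; first by rewrite setU11.
  rewrite /extend_block setU0 -JE (setD1_notin (x := set0)) ?setD1K//.
  by rewrite inE (partition0 partP) andbF.
have dis : [disjoint J :\ v & (v |: B) :\: J].
  by rewrite -setI_eq0; apply/eqP/setP => x; rewrite !inE; case: (x \in J);
    rewrite ?andbF.
split; first by rewrite [B]BJ; exact: partitionU1.
exists (J :\ v); first by rewrite !inE eqxx orbT.
rewrite /extend_block setD1K// setU1K ?setD1K//.
(* If the reduced block were itself a block of [P], a point [x] of it would lie in two blocks, so
   these would be equal, although only one of them contains [v]. *)
apply/negP => /setD1P[_ JvP]; have /set0Pn[x xJv] := J0.
have xJ : x \in J by move: xJv => /setD1P[].
have tP := partition_trivIset partP.
by have := def_pblock tP JvP xJv; rewrite (def_pblock tP JP xJ) => JJ; move: vJ;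
  rewrite JJ !inE eqxx.
Qed.

Local Open Scope ring_scope.

(** Group the partitions by their image under [drop_point v]; the fibre over [Q] is parametrised by
    [set0 |: Q] through [extend_block]. *)
Lemma sum_partition_setU1 (R : nmodType) (F : {set {set T}} -> R) v B :
  v \notin B ->
  \sum_(P | partition P (v |: B)) F P =
  \sum_(Q | partition Q B)
    (F ([set v] |: Q) + \sum_(I in Q) F (extend_block v Q I)).
Proof.
move=> vB; rewrite (partition_big (drop_point v) (fun Q => partition Q B)) /=; last first.
  by move=> P /(partition_drop vB)[].
apply: eq_bigr => Q partQ.
have Q0 : set0 \notin Q by rewrite (partition0 partQ).
rewrite (eq_bigl (mem [set extend_block v Q I | I in set0 |: Q])) => [|P]; last first.
  apply/idP/imsetP => [/andP[partP /eqP QE]|[I IQ ->]].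
    by have [_ [I IQ PE]] := partition_drop vB partP; exists I; rewrite -QE.
  by rewrite partition_extend//= (drop_extend vB)//.
rewrite big_imset /=.
  rewrite big_setU1//= /extend_block setU0 (setD1_notin Q0)//.
(* Injectivity: the block that contains [v] is [v |: I], and [v] lies in no block of [Q], so [I] can
   be recovered. *)
move=> I J I0Q J0Q IJ.
have vI := notin_block vB partQ I0Q; have vJ := notin_block vB partQ J0Q.
have : v |: I \in extend_block v Q J by rewrite -IJ /extend_block setU11.
case/setU1P => [/setP IJE|].
  apply/setP => x; have := IJE x; rewrite !inE; case: eqVneq => [->|//] _.
  by rewrite (negbTE vI) (negbTE vJ).
move=> /setD1P[_ vIQ]; have : v |: I \in set0 |: Q by rewrite inE vIQ orbT.
by move/(notin_block vB partQ); rewrite setU11.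
Qed.

End PartitionSplit.

(** * Sums over chain-rule blocks as sums over set partitions *)

Section FaaBlocksSum.
Local Open Scope ring_scope.

Definition block_sizes (T : finType) (P : {set {set T}}) : seq nat :=
  map (fun I : {set T} => #|I|) (enum P).

Lemma block_sizes_setU1 (T : finType) (P : {set {set T}}) (I : {set T}) :
  I \notin P -> perm_eq (block_sizes (I |: P)) (#|I| :: block_sizes P).
Proof.
move=> IP; rewrite -[_ :: _]/(map (fun J : {set T} => #|J|) (I :: enum P)).
apply: perm_map; apply: uniq_perm; first exact: enum_uniq.
  by rewrite /= mem_enum IP enum_uniq.
by move=> J; rewrite in_cons !mem_enum !inE.
Qed.

Lemma block_sizes_setD1 (T : finType) (P : {set {set T}}) (I : {set T}) :
  I \in P -> perm_eq (block_sizes P) (#|I| :: block_sizes (P :\ I)).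
Proof. by move=> IP; rewrite -{1}(setD1K IP) block_sizes_setU1// setD11. Qed.

Lemma perm_block_sizes_extend (T : finType) (v : T) (B : {set T})
    (Q : {set {set T}}) (I : {set T}) :
  v \notin B -> partition Q B -> I \in Q ->
  perm_eq (block_sizes (extend_block v Q I))
    (#|I|.+1 :: rem #|I| (block_sizes Q)).
Proof.
move=> vB partQ IQ; have I0Q : I \in set0 |: Q by rewrite inE IQ orbT.
have vI := notin_block vB partQ I0Q.
have vIQ : v |: I \notin Q :\ I.
  apply/negP => /setD1P[_ vIQ].
  have /(notin_block vB partQ) : v |: I \in set0 |: Q by rewrite inE vIQ orbT.
  by rewrite setU11.
rewrite (perm_trans (block_sizes_setU1 vIQ))// cardsU1 vI add1n perm_cons.
have IsQ : #|I| \in block_sizes Q by apply: map_f; rewrite mem_enum.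
by have := perm_rem_eq IsQ (block_sizes_setD1 IQ); rewrite /= eqxx perm_sym.
Qed.

(** Both sides obey the same recursion when one element is added, since it either is a block of its
    own or joins an existing block. A permutation-invariant weight does not see the order in which
    the blocks are listed. *)
Lemma sum_faa_blocks (R : nmodType) (T : Type) (S : finType) (ys : seq T)
    (A : {set S}) (w : seq nat -> R) : perm_invariant w -> #|A| = size ys ->
  \sum_(bl <- faa_blocks ys) w (map size bl) =
  \sum_(P | partition P A) w (block_sizes P).
Proof.
elim/last_ind: ys A w => [|ys y IH] A w w_perm.
  move/eqP; rewrite cards_eq0 => /eqP ->.
  rewrite /faa_blocks /= big_seq1 (eq_bigl (pred1 set0)); last exact: partition_set0.
  by rewrite big_pred1_eq /block_sizes enum_set0.
rewrite size_rcons => cardA.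
have /card_gt0P[v vA] : (0 < #|A|)%N by rewrite cardA.
have cardB : #|A :\ v| = size ys by move: cardA; rewrite (cardsD1 v) vA => -[].
have vB : v \notin A :\ v by rewrite setD11.
(* [Dw] sums [w] over all ways of adding one element to blocks of the given sizes. *)
pose Dw (sh : seq nat) := w (1%N :: sh) + \sum_(x <- sh) w (x.+1 :: rem x sh).
have Dw_perm : perm_invariant Dw.
  move=> s t st; congr (_ + _); first by apply: w_perm; rewrite perm_cons.
  rewrite -(perm_big _ st) !big_seq; apply: eq_bigr => x xs.
  by apply: w_perm; rewrite perm_cons; exact: perm_rem_eq.
rewrite -(setD1K vA) sum_partition_setU1// faa_blocks_rcons big_flatten big_map.
transitivity (\sum_(bl <- faa_blocks ys) Dw (map size bl)).
  apply: eq_bigr => bl _; rewrite /add_to_block big_cons map_rcons; congr (_ + _).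
    by apply: w_perm; rewrite perm_rcons.
  rewrite -(sum_repl _ _ w_perm) -(map_repl (h := @size T) (g := rcons^~ y)).
    by rewrite big_map.
  by move=> b; rewrite size_rcons.
rewrite (IH _ _ Dw_perm cardB); apply: eq_bigr => Q partQ; congr (_ + _).
  apply: w_perm; rewrite perm_sym.
  rewrite (perm_trans (block_sizes_setU1 _)) ?cards1//.
  apply/negP => vQ; have := subsetP (partitionS partQ vQ) v.
  by rewrite set11 (negbTE vB) => /(_ isT).
rewrite big_map big_enum; apply: eq_bigr => I IQ; apply: w_perm.
by rewrite perm_sym; exact: perm_block_sizes_extend vB partQ IQ.
Qed.

Lemma partition_card1 (T : finType) (P : {set {set T}}) (A : {set T}) :
  A != set0 -> (partition P A && (#|P| == 1%N)) = (P == [set A]).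
Proof.
move=> A0; apply/andP/eqP => [[partP /cards1P[I PE]]|->].
  by have := cover_partition partP; rewrite PE /cover big_set1 => ->.
rewrite cards1 /partition /trivIset /cover !big_set1 inE (eq_sym set0) A0 !eqxx.
by [].
Qed.

Lemma partition_card_le (T : finType) (P : {set {set T}}) (A : {set T}) :
  partition P A -> (#|P| <= #|A|)%N.
Proof.
move=> partP; rewrite (card_partition partP) -sum1_card; apply: leq_sum => I IP.
by rewrite card_gt0 (partition_neq0 partP IP).
Qed.

(* The sum over the partitions with at least two blocks is the recursion of
   Mcoef; the remaining partition has the single block of size k. *)
Lemma sum_faa_blocks_Mcoef (R : comNzRingType) (T : Type) (ys : seq T) (a t : R) :
  (1 < size ys)%N ->
  \sum_(bl <- faa_blocks ys) \prod_(n <- map size bl)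
    (if n == size ys then a else (Mcoef n)%:R * t ^+ n) =
  a + (Mcoef (size ys))%:R * t ^+ size ys.
Proof.
set k := size ys => k1; pose c n := if n == k then a else (Mcoef n)%:R * t ^+ n.
have w_perm : perm_invariant (fun sh => \prod_(n <- sh) c n).
  by move=> s u su; exact: perm_big.
rewrite (sum_faa_blocks (A := [set: 'I_k]) w_perm) ?cardsT ?card_ord//.
have T0 : [set: 'I_k] != set0 by rewrite -card_gt0 cardsT card_ord ltnW.
rewrite (bigID (fun P : {set {set 'I_k}} => #|P| == 1%N)) /=; congr (_ + _).
  rewrite (eq_bigl (pred1 [set [set: 'I_k]])) => [|P]; last exact: partition_card1.
  by rewrite big_pred1_eq big_map big_enum /= big_set1 cardsT card_ord /c eqxx.
rewrite Mcoef_rec// natr_sum mulr_suml big_nat_cond.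
under [RHS]eq_bigr do rewrite natr_sum mulr_suml.
(* With [P] summed first, the sum over [j] reduces to [j = #|P|], which lies between 2 and [k]. *)
rewrite (exchange_big_dep (fun P : {set {set 'I_k}} =>
  partition P [set: 'I_k] && (#|P| != 1%N))) /=; last first.
  by move=> j P /andP[/andP[j2 _] _] /andP[-> /eqP ->]; rewrite gtn_eqF.
apply: eq_bigr => P /andP[partP P1].
have Pk : (2 <= #|P| < k.+1)%N.
  have := partition_card_le partP; rewrite cardsT card_ord ltnS => ->; rewrite andbT.
  have P0 : P != set0.
    apply: contraTneq partP => ->; apply/negP => /cover_partition.
    by rewrite /cover big_set0 => /esym/eqP; rewrite (negbTE T0).
  by move: P1 P0; rewrite -cards_eq0; case: #|P| => [|[]].
rewrite [RHS](eq_bigl (fun j => j == #|P|)) => [|j]; last first.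
    by rewrite partP andbT/= eq_sym; case: eqVneq => [->|_]; rewrite ?Pk ?andbF.
rewrite -[RHS]big_filter filter_pred1_uniq ?iota_uniq ?mem_index_iota ?Pk// big_seq1.
rewrite big_map big_enum /= natr_prod.
(* The block sizes add up to [k], so [t ^+ k] distributes over the blocks. With at least two blocks
   each size is below [k], so [c] never takes the value [a]. *)
rewrite -[in t ^+ k](card_ord k) -cardsT (card_partition partP) -prodrXr -big_split.
apply: eq_bigr => I IP /=; rewrite /c ifN//.
rewrite neq_ltn (partition_block_lt partP _ IP)//.
by case/andP: Pk.
Qed.

End FaaBlocksSum.

(** For n >= 1, the partition of n + 1 points into one singleton and its complement contributes
    [Mcoef 1 * Mcoef n] to the recursion for [Mcoef n.+1]. *)
Lemma Mcoef_leS n : Mcoef n <= Mcoef n.+1.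
Proof.
case: n => [//|n]; rewrite [in leqRHS]Mcoef_rec//.
rewrite (bigD1_seq 2) ?iota_uniq ?mem_index_iota//= -[leqLHS]addn0 leq_add//.
set A : {set 'I_n.+2} := [set ord_max].
have cA : #|~: A| = n.+1 by rewrite cardsC1 card_ord.
have AcA : A != ~: A by apply/eqP => /setP/(_ ord_max); rewrite !inE eqxx.
rewrite (bigD1 [set A; ~: A]) /=; last first.
  rewrite cards2 AcA andbT -[[set: _]](setUCr A) partitionU1//.
  - have := @partition_card1 _ [set ~: A] (~: A).
    by rewrite eqxx cards1 eqxx andbT; apply; rewrite -card_gt0 cA.
  - by rewrite -card_gt0 cards1.
  - by rewrite -setI_eq0 setICr.
rewrite big_setU1 ?inE//= big_set1 cA cards1 Mcoef1 mul1n; exact: leq_addr.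
Qed.

Lemma Mcoef_leq : {homo Mcoef : m n / m <= n}.
Proof. by apply: homo_leq => //; [exact: leq_trans|exact: Mcoef_leS]. Qed.

(** * Contents and sizes of the blocks *)

Section FaaBlocksShape.
Context {T : eqType}.
Implicit Types (ys : seq T) (bl : seq (seq T)).

Lemma repl_rcons_flatten (v : T) bl c : c \in repl (rcons^~ v) bl ->
  perm_eq (flatten c) (v :: flatten bl).
Proof.
elim: bl c => [//|b bl IH] c /=; rewrite inE => /orP[/eqP->|/mapP[t /IH tbl ->]] /=.
  by rewrite cat_rcons -cat1s perm_catCA.
apply: (@perm_trans _ (b ++ v :: flatten bl)); first by rewrite perm_cat2l.
by rewrite -cat1s perm_catCA.
Qed.

Lemma repl_rcons_nil (v : T) bl c : c \in repl (rcons^~ v) bl ->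
  [::] \notin bl -> [::] \notin c.
Proof.
elim: bl c => [//|b bl IH] c /=; rewrite inE => /orP[/eqP->|/mapP[t /IH tbl ->]];
  rewrite !inE !negb_or => /andP[b0 bl0]; apply/andP; split => //.
  by case: (b).
exact: tbl.
Qed.

(** Used to regroup a product over all directions into products over blocks, and to see that the
    inner map is differentiated at least once in every block. *)
Lemma faa_blocks_spec ys bl : bl \in faa_blocks ys ->
  perm_eq (flatten bl) ys /\ [::] \notin bl.
Proof.
elim/last_ind: ys bl => [|ys v IH] bl; first by rewrite inE => /eqP->.
rewrite faa_blocks_rcons => /flatten_mapP[c /IH[cys c0]].
rewrite inE => /orP[/eqP->|cbl].
  split; last by rewrite mem_rcons inE negb_or.
  by rewrite flatten_rcons cats1 perm_rcons perm_sym perm_rcons perm_cons perm_sym.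
split; last exact: repl_rcons_nil cbl c0.
rewrite (perm_trans (repl_rcons_flatten cbl))// perm_sym perm_rcons perm_cons.
by rewrite perm_sym.
Qed.

Lemma size_faa_block ys bl b : bl \in faa_blocks ys -> b \in bl ->
  0 < size b <= size ys.
Proof.
move=> /faa_blocks_spec[/perm_size <- bl0] bbl; apply/andP; split.
  by rewrite lt0n size_eq0; apply: contraNneq bl0 => <-.
by have /perm_to_rem/perm_flatten/perm_size -> := bbl; rewrite size_cat leq_addr.
Qed.

Lemma size_faa_blocks ys bl : bl \in faa_blocks ys -> size bl <= size ys.
Proof.
move=> /faa_blocks_spec[/perm_size <-]; elim: bl => [//|b bl IH].
rewrite inE negb_or => /andP[b0 /IH {}IH]; rewrite /= size_cat -add1n leq_add//.
by rewrite lt0n size_eq0 eq_sym.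
Qed.

End FaaBlocksShape.

(* Required only here: mathcomp.classical shadows partition, cover, pblock. *)
From mathcomp Require Import all_classical all_reals all_analysis.
From mathcomp Require Import ring.

Import numFieldNormedType.Exports.
(* ssrnat.iterD shadows Defs.iterD otherwise. *)
Import Pilot.Defs.

Local Open Scope classical_set_scope.
Local Open Scope ring_scope.

(** * Maps of class C^1 *)

Section Directional.
Context {R : realType} {V W : normedModType R}.
Implicit Types (f : V -> W) (x v : V).

Lemma derive_lineE f x v t :
  (derivable (fun s : R => f (s *: v + x)) t 1 <-> derivable f (t *: v + x) v) /\
  'D_1 (fun s : R => f (s *: v + x)) t = 'D_v f (t *: v + x).
Proof.
rewrite /derivable /derive.
suff -> : (fun h : R => h^-1 *: (((fun s : R => f (s *: v + x)) \o shift t) (h *: 1)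
    - f (t *: v + x))) =
  (fun h : R => h^-1 *: ((f \o shift (t *: v + x)) (h *: v) - f (t *: v + x))).
  by [].
apply/funext => h /=; congr (_ *: (f _ - _)).
by rewrite [h *: 1]mulr1 scalerDl addrA.
Qed.

(** On the line through [x] along [v] derivability is differentiability, so the one-variable chain
    rule for scaling by [a] applies, also when [a = 0]. *)
Lemma is_deriveZdir f x v (a : R) : derivable f x v ->
  is_derive x (a *: v) f (a *: 'D_v f x).
Proof.
have [dl De] := derive_lineE f x v 0; have [dla Dea] := derive_lineE f x (a *: v) 0.
move: dl De dla Dea; rewrite !scale0r !add0r => dl De dla Dea.
move/dl/derivable1_diffP => Fd.
pose F := fun s : R => f (s *: v + x).
pose Z := *:%R^~ a : R -> R.
have Zd : is_diff (0 : R) Z Z by exact: is_diff_scalel.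
have FZ : differentiable F (Z 0) by rewrite /Z scale0r.
have FZE : (fun s : R => f (s *: (a *: v) + x)) = F \o Z.
  by apply/funext => s; rewrite /F /Z /= scalerA.
have dFZ : differentiable (F \o Z) (0 : R) by exact: differentiable_comp.
split; first by apply/dla; rewrite FZE; apply/derivable1_diffP.
rewrite -Dea FZE -De !deriveE// diff_comp// diff_val /= /Z scale0r scale1r.
by rewrite -[X in 'd _ _ X](mulr1 a) linearZ.
Qed.
End Directional.

Section MeanValue.
Context {R : realType} {V : normedModType R} {d : nat}.
Implicit Types (f : V -> 'rV[R]_d) (x v : V).

Lemma rV_norm_le (u : 'rV[R]_d) (e : R) : 0 <= e ->
  (forall j, `|u 0 j| <= e) -> `|u| <= e.
Proof.
move=> e0 ue; rewrite /Num.Def.normr/= mx_normrE (bigmax_le _ e0)//= => -[i j] _.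
by rewrite (ord1 i).
Qed.

Lemma rV_norm_ge (u : 'rV[R]_d) j : `|u 0 j| <= `|u|.
Proof.
by rewrite [leRHS]/Num.Def.normr/= mx_normrE; exact: (le_bigmax _ _ (0, j)).
Qed.

(** The scalar mean value theorem is applied to each coordinate. The intermediate points may differ,
    which does no harm because the norm of ['rV_d] is the maximum over the coordinates. *)
Lemma mean_value_rV f x v (l : 'rV[R]_d) (e : R) :
  (forall t : R, 0 <= t <= 1 -> derivable f (t *: v + x) v /\
     `|'D_v f (t *: v + x) - l| <= e) ->
  `|f (v + x) - f x - l| <= e.
Proof.
move=> fv; have e0 : 0 <= e.
  by have [|_] := fv 0; [rewrite lexx ler01|exact: le_trans].
apply: rV_norm_le => // j.
pose F (t : R) := f (t *: v + x) 0 j.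
have dF (t : R) : 0 <= t <= 1 -> is_derive t 1 F ('D_v f (t *: v + x) 0 j).
  move=> /fv[fd _]; have [[_ /(_ fd) G] <-] := derive_lineE f x v t.
  rewrite derive_mx// mxE; split => //.
  by move/derivable_mxP : G; exact.
have dF' (t : R) : t \in `]0, 1[%R -> is_derive t 1 F ('D_v f (t *: v + x) 0 j).
  by rewrite in_itv/= => /andP[t0 t1]; apply: dF; rewrite !ltW.
have [|c] := MVT_segment ler01 dF'.
  apply: derivable_within_continuous => t; rewrite in_itv/= => /dF[] //.
rewrite in_itv/= => c01.
rewrite /F scale1r scale0r add0r subr0 mulr1 !mxE => ->.
have [_] := fv c c01; apply: le_trans.
by have := rV_norm_ge ('D_v f (c *: v + x) - l) j; rewrite !mxE.
Qed.

End MeanValue.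

Section C1.
Context {R : realType}.
Implicit Types V W : normedModType R.

(* Every normed space W has this property. It is assumed rather than proved
   because only W = 'rV_d is needed, where it follows coordinatewise. *)
Definition has_mean_value V W : Prop :=
  forall (f : V -> W) (x v : V) (l : W) (e : R),
  (forall t : R, 0 <= t <= 1 -> derivable f (t *: v + x) v /\
     `|'D_v f (t *: v + x) - l| <= e) ->
  `|f (v + x) - f x - l| <= e.

(** Linearity in the direction is not part of the notion; under the mean value property it follows,
    by [C1_deriveDdir]. *)
Definition C1_at V W (f : V -> W) (x : V) : Prop :=
  ((\forall y \near x, forall v, derivable f y v) /\
  forall v, {for x, continuous ('D_v f)})%type.

(** Compare the increment of [f] along the segment from [x] to [x + t(v + w)] with the detour
    through [x + t w]. By the mean value property each of the three increments is within [t e / 3]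
    of [t] times the derivative at [x]; then divide by [t]. *)
Lemma C1_deriveDdir V W (f : V -> W) (x v w : V) : has_mean_value V W ->
  C1_at f x -> 'D_(v + w) f x = 'D_v f x + 'D_w f x.
Proof.
move=> MV [fd fc]; apply/eqP; rewrite -subr_eq0 -normr_le0.
apply/ler_addgt0Pl => e e0.
rewrite addr0; have e3 : 0 < e / 3%:R by rewrite divr_gt0.
have fce u : \forall y \near x, `|'D_u f y - 'D_u f x| <= e / 3%:R.
  by have /cvgrPdist_le/(_ _ e3) := fc u; apply: filterS => y; rewrite distrC.
have /nbhs_ballP[r /= r0 rP] : \forall y \near x, (forall u, derivable f y u) /\
    (`|'D_v f y - 'D_v f x| <= e / 3%:R /\ `|'D_w f y - 'D_w f x| <= e / 3%:R) /\
    `|'D_(v + w) f y - 'D_(v + w) f x| <= e / 3%:R.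
  near=> y; split; first by near: y.
  by split; [split|]; near: y; exact: fce.
have [t t0 tr] : exists2 t : R, 0 < t & t * (`|v| + `|w|) < r.
  have s0 : 0 < `|v| + `|w| + 1 by rewrite ltr_wpDl// addr_ge0.
  (* The summand 1 keeps the denominator positive when [v = w = 0]. *)
  exists (r / (`|v| + `|w| + 1)); first exact: divr_gt0.
  by rewrite mulrAC ltr_pdivrMr// ltr_pM2l// ltrDl.
(* The parallelogram spanned by [t *: v] and [t *: w] contains the direct segment (a = b) and both
   legs of the detour (a = 0, then b = 1). *)
have near_pt (a b : R) : 0 <= a <= 1 -> 0 <= b <= 1 ->
    ball x r (a *: (t *: v) + (b *: (t *: w) + x)).
  move=> /andP[a0 a1] /andP[b0 b1]; rewrite -ball_normE /= distrC addrA addrK.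
  apply: le_lt_trans tr.
  rewrite (le_trans (ler_normD _ _))// mulrDr !normrZ.
  rewrite (ger0_norm a0) (ger0_norm b0) (gtr0_norm t0).
  by rewrite lerD// ler_piMl// mulr_ge0// ltW.
have mv u y : (forall a : R, 0 <= a <= 1 -> ball x r (a *: (t *: u) + y)) ->
    (forall y, ball x r y -> `|'D_u f y - 'D_u f x| <= e / 3%:R) ->
    `|f (t *: u + y) - f y - t *: 'D_u f x| <= t * (e / 3%:R).
  move=> yr ur; apply: MV => a /yr ar.
  have [/(_ u) /(is_deriveZdir t)[fa ->] _] := rP _ ar; split => //.
  by rewrite -scalerBr normrZ gtr0_norm// ler_pM2l// ur.
have u01 : 0 <= (1 : R) <= 1 by rewrite ler01 lexx.
have z01 : 0 <= (0 : R) <= 1 by rewrite ler01 lexx.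
have mvw : `|f (t *: (v + w) + x) - f x - t *: 'D_(v + w) f x| <= t * (e / 3%:R).
  apply: mv => [a a01|y /rP[_ []]//].
  by rewrite !scalerDr -addrA; exact: near_pt.
have mw : `|f (t *: w + x) - f x - t *: 'D_w f x| <= t * (e / 3%:R).
  apply: mv => [a a01|y /rP[_ [[]]]//].
  by have := near_pt 0 a z01 a01; rewrite scale0r add0r.
have mv' : `|f (t *: v + (t *: w + x)) - f (t *: w + x) - t *: 'D_v f x|
    <= t * (e / 3%:R).
  apply: mv => [a a01|y /rP[_ [[]]]//].
  by have := near_pt a 1 a01 u01; rewrite scale1r.
have telescope (F0 F1 F2 a b c : W) :
    a + b - c = F2 - F0 - c - (F2 - F1 - a) - (F1 - F0 - b).
  rewrite -[F2 - F0](subrKA F1) -[RHS]addrA -opprD.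
  by rewrite (addrACA (F2 - F1)) -opprD opprB [RHS]addrC !subrKA.
rewrite -(ler_pM2l t0) -[X in X * `|_|](gtr0_norm t0) -normrZ.
rewrite -normrN -scalerN opprB scalerBr scalerDr.
rewrite (telescope (f x) (f (t *: w + x)) (f (t *: v + (t *: w + x)))).
move: mvw; rewrite [t *: (v + w)]scalerDr -(addrA (t *: v)) => mvw.
have -> : t * e = t * (e / 3%:R) + t * (e / 3%:R) + t * (e / 3%:R) by field.
apply: (le_trans (ler_normB _ _)); apply: lerD mw.
by apply: (le_trans (ler_normB _ _)); exact: lerD mvw mv'.
Unshelve. all: by end_near. Qed.

End C1.

Lemma continuous_at_sum (R : realType) (T : topologicalType)
    (W : normedModType R) (I : Type) (r : seq I) (F : I -> T -> W) (x : T) :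
  (forall i, {for x, continuous (F i)}) ->
  {for x, continuous (fun y => \sum_(i <- r) F i y)}.
Proof.
move=> Fc; elim: r => [|i r IH].
  rewrite (_ : (fun _ => _) = cst 0); first exact: cst_continuous.
  by apply/funext => y; rewrite big_nil.
rewrite (_ : (fun _ => _) = F i \+ (fun y => \sum_(i <- r) F i y)).
  exact: continuousD.
by apply/funext => y; rewrite big_cons.
Qed.

Section C1coordinates.
Context {R : realType} {V W : normedModType R} {n : nat}.
Context (c : 'I_n -> {linear V -> R^o}) (b : 'I_n -> V).
Context (cb : forall v, v = \sum_i c i v *: b i)
  (c_cont : forall i, continuous (c i)) (c_le : forall i v, `|c i v| <= `|v|).
Context (MV : has_mean_value V W).

Lemma C1_derive_sum (f : V -> W) (x v : V) :
  C1_at f x -> 'D_v f x = \sum_i c i v *: 'D_(b i) f x.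
Proof.
move=> fx; rewrite {1}(cb v).
rewrite (big_morph (fun v => 'D_v f x) (fun v w => C1_deriveDdir v w MV fx)
  (derive0 f x)).
apply: eq_bigr => i _; have [/nbhs_singleton fd _] := fx.
by have [_ ->] := is_deriveZdir (c i v) (fd (b i)).
Qed.

(** The candidate differential is [df]. On the segment from [x] to [h + x] the derivative along [h]
    differs from [df h] by at most [|h|] times the sum of the variations of the partial derivatives,
    and the mean value property transfers this to the increment of [f]. *)
Lemma C1_differentiable (f : V -> W) (x : V) :
  (\forall y \near x, C1_at f y) -> differentiable f x.
Proof.
move=> fC1; have fx := nbhs_singleton fC1.
pose df (v : V) := \sum_i c i v *: 'D_(b i) f x.
have df_lin : linear df.
  move=> a u v; rewrite /df scaler_sumr -big_split; apply: eq_bigr => i _ /=.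
  by rewrite linearD linearZ scalerDl scalerA.
pose dfL : {linear V -> W} := HB.pack df (GRing.isLinear.Build _ _ _ _ _ df_lin).
have df_cont : continuous dfL.
  move=> v; apply: (@continuous_at_sum R V W 'I_n _
    (fun i y => c i y *: 'D_(b i) f x)) => i.
  exact/continuousZr_tmp/c_cont.
have dfo : f \o shift x = cst (f x) + dfL +o_ 0 id.
  apply/eqaddoP => _/posnumP[e].
  have : \forall y \near x, C1_at f y /\
      \sum_i `|'D_(b i) f y - 'D_(b i) f x| <= e%:num.
    near=> y; split; first by near: y.
    near: y.
    have sc : {for x, continuous
        (fun y => \sum_i `|'D_(b i) f y - 'D_(b i) f x|)}.
      apply: continuous_at_sum => i; apply: cvg_norm; apply: cvgB; last exact: cvg_cst.
      by have [_] := fx; apply.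
    have /cvgrPdist_le/(_ _ [gt0 of e%:num]) := sc.
    apply: filterS => y; rewrite [X in `|X - _|]big1; last first.
      by move=> i _; rewrite subrr normr0.
    rewrite sub0r normrN; exact: le_trans (ler_norm _).
  move/nbhs_ballP => [r /= r0 rP]; near=> h.
  have hr : `|h| < r by near: h; exact: nbhs0_lt.
  rewrite [X in `|X|](_ : _ = f (h + x) - f x - df h); last first.
    by rewrite -addrA -opprD.
  apply: MV => t /andP[t0 t1].
  have /rP[fy fyx] : ball x r (t *: h + x).
    rewrite -ball_normE /= distrC addrK normrZ ger0_norm//.
    by apply: le_lt_trans hr; exact: ler_piMl.
  split; first by case: fy => /nbhs_singleton.
  rewrite (C1_derive_sum h fy) /df -sumrB.
  rewrite (le_trans (ler_norm_sum _ _ _))//.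
  apply: le_trans (ler_wpM2r (normr_ge0 h) fyx); rewrite mulr_suml.
  apply: ler_sum => i _; rewrite -scalerBr normrZ mulrC.
  by apply: ler_wpM2l; [exact: normr_ge0|exact: c_le].
by apply/diff_locallyP; rewrite (diff_unique df_cont dfo).
Unshelve. all: by end_near. Qed.

End C1coordinates.

Section C1rV.
Context {R : realType} {n d : nat}.
Local Notation E := 'rV[R]_n.

Definition rV_coord (i : 'I_n) (u : E) : R^o := u 0 i.

Lemma rV_coord_linear i : linear (rV_coord i).
Proof. by move=> a u v; rewrite /rV_coord !mxE. Qed.

HB.instance Definition _ i :=
  GRing.isLinear.Build _ _ _ _ _ (rV_coord_linear i).

Lemma C1_derive_rV (f : E -> 'rV[R]_d) (x v : E) :
  C1_at f x -> 'D_v f x = \sum_i v 0 i *: 'D_(delta_mx 0 i) f x.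
Proof.
apply: (@C1_derive_sum R E _ n rV_coord (delta_mx 0)).
- exact: row_sum_delta.
- exact: mean_value_rV.
Qed.

Lemma C1_differentiable_rV (f : E -> 'rV[R]_d) (x : E) :
  (\forall y \near x, C1_at f y) -> differentiable f x.
Proof.
apply: (@C1_differentiable R E _ n rV_coord (delta_mx 0)).
- exact: row_sum_delta.
- by move=> i; exact: coord_continuous.
- by move=> i v; exact: rV_norm_ge.
- exact: mean_value_rV.
Qed.

End C1rV.

(** * Iterated directional derivatives *)

Section DeriveExtra.
Context {R : realType} {V W : normedModType R}.

Lemma is_derive_bigsum (I : Type) (r : seq I) (F : I -> V -> W) (dF : I -> W)
    (x v : V) : (forall i, is_derive x v (F i) (dF i)) ->
  is_derive x v (fun y => \sum_(i <- r) F i y) (\sum_(i <- r) dF i).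
Proof.
move=> Fd; elim: r => [|i r IH].
  rewrite big_nil (_ : (fun _ => _) = cst 0); first exact: is_derive_cst.
  by apply/funext => y; rewrite big_nil.
rewrite big_cons (_ : (fun _ => _) = F i + (fun y => \sum_(i <- r) F i y)).
  exact: is_deriveD.
by apply/funext => y; rewrite big_cons.
Qed.

(** Only directional derivatives are given, so the product rule is read off the difference quotient;
    continuity of [k] enters only along the line through [x]. *)
Lemma is_deriveZfun (k : V -> R) (g : V -> W) (x v : V) (dk : R) (dg : W) :
  is_derive x v (k : V -> R^o) dk -> is_derive x v g dg ->
  is_derive x v (fun y => k y *: g y) (k x *: dg + dk *: g x).
Proof.
move=> [kd <-] [gd <-].
have lim : (fun h : R => h^-1 *: (((fun y => k y *: g y) \o shift x) (h *: v) -
    k x *: g x)) @ 0^' --> k x *: 'D_v g x + 'D_v (k : V -> R^o) x *: g x.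
  rewrite [X in X @ _](_ : _ = fun h : R =>
      k (h *: v + x) *: (h^-1 *: (g (h *: v + x) - g x)) +
      (h^-1 *: (k (h *: v + x) - k x : R^o)) *: g x); last first.
    apply/funext => h /=; set y := h *: v + x.
    rewrite -[h^-1 *: (k y - k x : R^o)]/(h^-1 * (k y - k x)) -scalerA.
    rewrite [k y *: (_ *: _)]scalerA (mulrC (k y)) -scalerA -scalerDr.
    by congr (_ *: _); rewrite scalerBr scalerBl addrA subrK.
  apply: cvgD; last exact: cvgZr_tmp kd.
  apply: cvgZ; last exact: gd.
  suff : {for 0, continuous (fun h : R => k (h *: v + x) : R^o)}.
    by move=> /continuous_withinNx; rewrite scale0r add0r.
  exact/differentiable_continuous/derivable1_diffP/(derivable1P _ _ _).1.
split; last exact: cvg_lim lim.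
by apply/cvg_ex; eexists; exact: lim.
Qed.

End DeriveExtra.

Lemma is_derive_comp_diff {R : realType} {U V W : normedModType R}
    (f : V -> W) (g : U -> V) (x v : U) :
  differentiable g x -> differentiable f (g x) ->
  is_derive x v (f \o g) ('D_('D_v g x) f (g x)).
Proof.
move=> gd fd; have fgd : differentiable (f \o g) x by exact: differentiable_comp.
by split; [exact: diff_derivable|rewrite !deriveE// diff_comp].
Qed.

Section SmoothOpen.
Context {R : realType} {d : nat}.
Local Notation E := 'rV[R]_d.
Implicit Types (f g : E -> E) (U : set E) (x v : E) (ys zs : seq E).

Lemma iterD_cat f ys zs : iterD f (ys ++ zs) = iterD (iterD f ys) zs.
Proof. exact: foldl_cat. Qed.

Lemma iterD_rcons f ys v : iterD f (rcons ys v) = 'D_v (iterD f ys).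
Proof. by rewrite -cats1 iterD_cat. Qed.

Lemma smooth_open_iterD U f ys : smooth_open U f -> smooth_open U (iterD f ys).
Proof. by move=> fs zs x Ux; rewrite -iterD_cat; exact: fs. Qed.

Lemma smooth_open_derive U f v : smooth_open U f -> smooth_open U ('D_v f).
Proof. by move/(@smooth_open_iterD _ _ [:: v]). Qed.

Lemma smooth_open_sub U V f : V `<=` U -> smooth_open U f -> smooth_open V f.
Proof. by move=> VU fs ys x /VU; exact: fs. Qed.

Lemma smooth_open_C1 U f x : open U -> smooth_open U f -> U x -> C1_at f x.
Proof.
move=> oU fs Ux; split.
  near=> y; move=> v; apply: (fs [::] y _).2; near: y.
  exact: open_nbhs_nbhs.
by move=> v; apply: (fs [:: v] x _).1.
Unshelve. all: by end_near. Qed.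

(** The passage from directional to total differentiability, on which the chain rule for [f \o psi]
    rests. *)
Lemma smooth_open_differentiable U f x :
  open U -> smooth_open U f -> U x -> differentiable f x.
Proof.
move=> oU fs Ux; apply: C1_differentiable_rV; near=> y.
apply: smooth_open_C1 fs _ => //; near: y.
exact: open_nbhs_nbhs.
Unshelve. all: by end_near. Qed.

Lemma open_eq_derive U f g x v : open U -> (forall y, U y -> f y = g y) -> U x ->
  'D_v f x = 'D_v g x.
Proof.
move=> oU fg Ux; apply: near_eq_derive; near=> y; apply: fg; near: y.
exact: open_nbhs_nbhs.
Unshelve. all: by end_near. Qed.

Lemma open_eq_iterD U f g x ys : open U -> (forall y, U y -> f y = g y) -> U x ->
  iterD f ys x = iterD g ys x.
Proof.
move=> oU; elim: ys f g x => [|y ys IH] f g x fg Ux; first exact: fg.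
by apply: (IH _ _ _ _ Ux) => z Uz; exact: (open_eq_derive y oU fg Uz).
Qed.

Lemma near_eq_continuous_at (T T' : topologicalType) (f g : T -> T') (x : T) :
  (\forall y \near x, f y = g y) -> {for x, continuous f} ->
  {for x, continuous g}.
Proof.
move=> fg fc; have fgx : f @ x --> g x by rewrite -(nbhs_singleton fg).
by apply: cvg_trans fgx; apply: near_eq_cvg; apply: filterS fg.
Qed.

Lemma iterD_cst0 ys : iterD (cst 0 : E -> E) ys = cst 0.
Proof.
elim: ys => [//|y ys IH]; rewrite /= (_ : 'D_y (cst 0) = cst 0)//.
by apply/funext => x; rewrite derive_cst.
Qed.

Lemma iterD_add U f g x ys : open U -> smooth_open U f -> smooth_open U g ->
  U x -> iterD (f + g) ys x = iterD f ys x + iterD g ys x.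
Proof.
move=> oU; elim: ys f g x => [//|y ys IH] f g x fs gs Ux /=.
rewrite -(IH ('D_y f) ('D_y g) x (smooth_open_derive y fs)
  (smooth_open_derive y gs) Ux).
apply: (open_eq_iterD ys oU) => [z Uz|//].
exact: deriveD ((fs [::] z Uz).2 y) ((gs [::] z Uz).2 y).
Qed.

Lemma iterD_scale U (a : R) f x ys : open U -> smooth_open U f ->
  U x -> iterD (a *: f) ys x = a *: iterD f ys x.
Proof.
move=> oU; elim: ys f x => [//|y ys IH] f x fs Ux /=.
rewrite -(IH ('D_y f) x (smooth_open_derive y fs) Ux).
apply: (open_eq_iterD ys oU) => [z Uz|//].
exact: deriveZ ((fs [::] z Uz).2 y).
Qed.

Lemma smooth_open_add U f g : open U -> smooth_open U f -> smooth_open U g ->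
  smooth_open U (f + g).
Proof.
move=> oU fs gs ys x Ux.
have [fc fd] := fs ys x Ux; have [gc gd] := gs ys x Ux.
have fgx : \forall y \near x, (iterD f ys + iterD g ys) y = iterD (f + g) ys y.
  near=> y; rewrite (iterD_add _ oU)//; near: y.
  exact: open_nbhs_nbhs.
split; first exact: (near_eq_continuous_at fgx (continuousD fc gc)).
by move=> v; exact: (near_eq_derivable fgx (derivableD (fd v) (gd v))).
Unshelve. all: by end_near. Qed.

Lemma smooth_open_scale U (a : R) f : open U -> smooth_open U f ->
  smooth_open U (a *: f).
Proof.
move=> oU fs ys x Ux; have [fc fd] := fs ys x Ux.
have fgx : \forall y \near x, (a *: iterD f ys) y = iterD (a *: f) ys y.
  near=> y; rewrite (iterD_scale _ _ oU)//; near: y.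
  exact: open_nbhs_nbhs.
split; first exact: (near_eq_continuous_at fgx (continuousZl_tmp fc)).
by move=> v; apply: (near_eq_derivable fgx); exact: derivableZ.
Unshelve. all: by end_near. Qed.

Lemma smooth_open_cst0 U : smooth_open U (cst 0 : E -> E).
Proof.
move=> ys x _; rewrite iterD_cst0; split; first exact: cst_continuous.
by move=> v; exact: derivable_cst.
Qed.

Lemma iterD_sum U (I : Type) (r : seq I) (a : I -> R) (F : I -> E -> E) x ys :
  open U -> (forall i, smooth_open U (F i)) -> U x ->
  iterD (fun y => \sum_(i <- r) a i *: F i y) ys x =
  \sum_(i <- r) a i *: iterD (F i) ys x.
Proof.
move=> oU Fs Ux.
(* The sum rule in the induction step needs a smooth tail, so smoothness is carried along. *)
suff [] : smooth_open U (fun y => \sum_(i <- r) a i *: F i y) /\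
  iterD (fun y => \sum_(i <- r) a i *: F i y) ys x =
  \sum_(i <- r) a i *: iterD (F i) ys x by [].
elim: r => [|i r [IHs IH]].
  rewrite big_nil (_ : (fun _ => _) = cst 0).
    by rewrite iterD_cst0; split; first exact: smooth_open_cst0.
  by apply/funext => y; rewrite big_nil.
rewrite big_cons.
rewrite (_ : (fun _ => _) = a i *: F i + (fun y => \sum_(i <- r) a i *: F i y)).
  have ais := smooth_open_scale (a i) oU (Fs i).
  split; first exact: (smooth_open_add oU ais IHs).
  by rewrite (iterD_add ys oU ais IHs Ux) IH (iterD_scale (a i) ys oU (Fs i) Ux).
by apply/funext => y; rewrite big_cons.
Qed.

(** Serves to replace a direction that varies with the point by fixed basis directions with varying
    coefficients. *)
Lemma iterD_cons_sum U f x v ys : open U -> smooth_open U f -> U x ->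
  iterD f (v :: ys) x = \sum_i v 0 i *: iterD f (delta_mx 0 i :: ys) x.
Proof.
move=> oU fs Ux.
have fis (i : 'I_d) : smooth_open U ('D_(delta_mx 0 i) f).
  exact: smooth_open_derive.
rewrite -(iterD_sum _ (fun i => v 0 i) ys oU fis Ux).
apply: (open_eq_iterD ys oU) => [y Uy|//].
exact: C1_derive_rV (smooth_open_C1 oU fs Uy).
Qed.

Lemma iterD_scale_dirs U f x (ps : seq (R * E)) : open U -> smooth_open U f ->
  U x -> iterD f [seq p.1 *: p.2 | p <- ps] x =
  (\prod_(p <- ps) p.1) *: iterD f [seq p.2 | p <- ps] x.
Proof.
move=> oU; elim: ps f => [|[a v] ps IH] f fs Ux; first by rewrite big_nil scale1r.
rewrite big_cons -scalerA -(IH _ (smooth_open_derive v fs) Ux) /=.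
rewrite -(iterD_scale a _ oU (smooth_open_derive v fs) Ux).
apply: (open_eq_iterD _ oU) => [y Uy|//].
by have [_ ->] := is_deriveZdir a ((fs [::] y Uy).2 v).
Qed.

End SmoothOpen.

(** * Faa di Bruno's formula *)

Section FaaDiBruno.
Context {R : realType} {d : nat}.
Local Notation E := 'rV[R]_d.
Implicit Types (f g psi u : E -> E) (U V : set E) (x v : E) (ys : seq E).

Definition regular_on U u : Prop :=
  forall x, U x -> {for x, continuous u} /\ (forall v, derivable u x v).

(** The derivative along [v] falls either on the argument [psi] of the outer derivative, which
    appends the direction ['D_v psi x], or on one of the moving directions, which gives the sum over
    [repl]. The induction peels off the first direction. *)
Lemma derive_iterD_moving U V psi (us : seq (E -> E)) f x :
  open U -> open V -> smooth_open U psi -> (forall y, U y -> V (psi y)) ->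
  (forall i, (i < size us)%N -> regular_on U (nth idfun us i)) ->
  smooth_open V f -> U x ->
  let G := fun y => iterD f [seq u y | u <- us] (psi y) in
  {for x, continuous G} /\
  forall v, is_derive x v G
    (iterD f (rcons [seq u x | u <- us] ('D_v psi x)) (psi x) +
     \sum_(t <- repl (fun u => 'D_v u) us) iterD f [seq u x | u <- t] (psi x)).
Proof.
move=> oU oV psis psiV; elim: us f => [|u us IH] f us_reg fs Ux G.
  have psid : differentiable psi x := smooth_open_differentiable oU psis Ux.
  have fd : differentiable f (psi x).
    exact: smooth_open_differentiable oV fs (psiV x Ux).
  split.
    apply: (@differentiable_continuous _ _ _ _ (f \o psi)).
    exact: differentiable_comp.
  by move=> v; rewrite big_nil addr0; exact: is_derive_comp_diff.
have [uc ud] := us_reg 0%N isT x Ux.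
have IHj (j : 'I_d) := IH ('D_(delta_mx 0 j) f)
  (fun i => us_reg i.+1) (smooth_open_derive _ fs) Ux.
(* Expanding the first direction in the basis makes [G] a sum of scalar coordinates times functions
   of the same kind with one direction fewer. *)
have GE : \forall y \near x, \sum_j u y 0 j *:
    iterD ('D_(delta_mx 0 j) f) [seq u y | u <- us] (psi y) = G y.
  near=> y; rewrite /G; apply/esym/(iterD_cons_sum _ _ oV fs)/psiV; near: y.
  exact: open_nbhs_nbhs.
split.
  apply: (near_eq_continuous_at GE).
  apply: continuous_at_sum => j.
  have [Gjc _] := IHj j; apply: cvgZ Gjc.
  exact: (continuous_comp uc (@coord_continuous _ _ _ 0 j (u x))).
move=> v; apply: (near_eq_is_derive GE).
have ujd (j : 'I_d) : is_derive x v (fun y => u y 0 j : R^o) ('D_v u x 0 j).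
  have uv := ud v; rewrite derive_mx// mxE; split => //.
  by move/derivable_mxP : uv; exact.
have dG (j : 'I_d) :=
  is_deriveZfun (k := fun y => u y 0 j) (ujd j) ((IHj j).2 v).
apply: is_derive_eq; first exact: (is_derive_bigsum _ dG).
have psix := psiV x Ux.
(* Each term of the claimed derivative is expanded along its first direction, so that both sides
   agree index by index. *)
have exp1 ys w := iterD_cons_sum w ys oV fs psix.
rewrite big_split /= big_cons big_map /=.
rewrite [X in _ = X + _](exp1 (rcons [seq u x | u <- us] ('D_v psi x)) (u x)).
rewrite [X in _ = _ + (X + _)](exp1 [seq u x | u <- us] ('D_v u x)).
rewrite [X in _ = _ + (_ + X)](eq_bigr _ (fun t _ => exp1 [seq u x | u <- t] (u x))).
rewrite exchange_big /= addrCA [RHS]addrC; congr (_ + _).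
rewrite -big_split /=; apply: eq_bigr => j _.
by rewrite scalerDr scaler_sumr.
Unshelve. all: by end_near. Qed.

Definition faa_term f psi (bl : seq (seq E)) x : E :=
  iterD f [seq iterD psi b x | b <- bl] (psi x).

(** The two kinds of terms match [add_to_block]: the new block [[:: v]] comes from the outer map, an
    enlarged block from an inner derivative. *)
Lemma derive_faa_term U V psi f (bl : seq (seq E)) x :
  open U -> open V -> smooth_open U psi -> (forall y, U y -> V (psi y)) ->
  smooth_open V f -> U x ->
  {for x, continuous (faa_term f psi bl)} /\
  forall v, is_derive x v (faa_term f psi bl)
    (\sum_(c <- add_to_block v bl) faa_term f psi c x).
Proof.
move=> oU oV psis psiV fs Ux.
have reg i : (i < size (map (iterD psi) bl))%N ->
    regular_on U (nth idfun (map (iterD psi) bl) i).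
  rewrite size_map => ib; rewrite (nth_map [::])// => y Uy; exact: psis.
have := derive_iterD_moving oU oV psis psiV reg fs Ux.
rewrite (_ : (fun y => _) = faa_term f psi bl); last first.
  by apply/funext => y; rewrite -map_comp.
move=> [Gc Gd]; split => // v; apply: is_derive_eq (Gd v) _.
rewrite /add_to_block big_cons /faa_term map_rcons -map_comp; congr (_ + _).
rewrite -(map_repl (h := iterD psi) (g := rcons^~ v)); last first.
  by move=> b; rewrite iterD_rcons.
by rewrite big_map; apply: eq_bigr => t _; rewrite -map_comp.
Qed.

Lemma iterD_comp U V psi f x ys :
  open U -> open V -> smooth_open U psi -> (forall y, U y -> V (psi y)) ->
  smooth_open V f -> U x ->
  iterD (f \o psi) ys x = \sum_(bl <- faa_blocks ys) faa_term f psi bl x.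
Proof.
move=> oU oV psis psiV fs; elim/last_ind: ys x => [|ys v IH] x Ux.
  by rewrite /faa_blocks /= big_seq1.
rewrite iterD_rcons (open_eq_derive v oU IH Ux).
have dt (bl : seq (seq E)) := (derive_faa_term bl oU oV psis psiV fs Ux).2 v.
have [_ ->] := is_derive_bigsum (faa_blocks ys) dt.
by rewrite faa_blocks_rcons big_flatten big_map.
Qed.

(** Near [x] the iterated derivative is a finite sum of terms, each of which is continuous and
    derivable. *)
Lemma smooth_open_comp U V psi f :
  open U -> open V -> smooth_open U psi -> (forall y, U y -> V (psi y)) ->
  smooth_open V f -> smooth_open U (f \o psi).
Proof.
move=> oU oV psis psiV fs ys x Ux.
have sumE : \forall y \near x, \sum_(bl <- faa_blocks ys) faa_term f psi bl y =
    iterD (f \o psi) ys y.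
  near=> y; apply/esym/(iterD_comp _ oU oV psis psiV fs); near: y.
  exact: open_nbhs_nbhs.
have dt (bl : seq (seq E)) := derive_faa_term bl oU oV psis psiV fs Ux.
split.
  apply: (near_eq_continuous_at sumE); apply: continuous_at_sum => bl.
  exact: (dt bl).1.
move=> v; apply: (near_eq_derivable sumE).
by have [] := is_derive_bigsum (faa_blocks ys) (fun bl => (dt bl).2 v).
Unshelve. all: by end_near. Qed.

End FaaDiBruno.

(** * Bounds for the C^k-norms *)

Section Extension.
Context {R : realType} {d : nat}.
Local Notation E := 'rV[R]_d.
Implicit Types (f g psi phi : E -> E) (Omega U : set E) (x y : E) (ys : seq E).

Lemma iterD_id x ys :
  iterD (idfun : E -> E) ys x =
  if ys is y :: ys' then if ys' is [::] then y else 0 else x.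
Proof.
case: ys => [//|y ys]; rewrite /= (_ : 'D_y idfun = cst y); last first.
  by apply/funext => z; exact: derive_id.
case: ys => [//|z ys]; rewrite /= (_ : 'D_z (cst y) = cst 0); last first.
  by apply/funext => w; rewrite derive_cst.
by rewrite iterD_cst0.
Qed.

Lemma smooth_open_id U : smooth_open U (idfun : E -> E).
Proof.
case=> [|y [|z ys]] x _; split.
- by move=> ?.
- by move=> v; exact: derivable_id.
- rewrite /= (_ : 'D_y idfun = cst y); first exact: cst_continuous.
  by apply/funext => z; exact: derive_id.
- move=> v; rewrite /= (_ : 'D_y idfun = cst y); first exact: derivable_cst.
  by apply/funext => z; exact: derive_id.
- rewrite (_ : iterD _ _ = cst 0); first exact: cst_continuous.
  by apply/funext => w; exact: iterD_id.
- move=> v; rewrite (_ : iterD _ _ = cst 0); first exact: derivable_cst.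
  by apply/funext => w; exact: iterD_id.
Qed.

(** At interior points only nearby values matter. At the others density of the interior makes the
    filter proper, so the limit is unique, and it is the value at [x] of the continuous derivative
    of the extension. *)
Lemma derivkE Omega U f g k x (ys : k.-tuple E) :
  dense_interior Omega -> open U -> Omega `<=` U -> smooth_open U g ->
  (forall y, Omega y -> f y = g y) -> Omega x ->
  derivk Omega f x ys = iterD g ys x.
Proof.
move=> dO oU OU gs fg Ox.
have fgi y : Omega° y -> iterD f ys y = iterD g ys y.
  move=> Oy; apply: (open_eq_iterD ys (@open_interior _ Omega)) => // z Oz.
  apply: fg; exact: interior_subset.
rewrite /derivk; case: asboolP => [|_]; first exact: fgi.
have Fx : ProperFilter (within Omega° (nbhs x)).
  by apply: within_nbhs_proper; exact: dO.
apply: (@cvg_lim E (@norm_hausdorff R E)).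
apply: (@cvg_trans _ (iterD g ys z @[z --> within Omega° (nbhs x)])).
  by apply: fmap_within_eq => z; rewrite inE => /fgi.
apply: cvg_within_filter; exact: (gs ys x (OU x Ox)).1.
Qed.

(** The extension is [g - id], with [g] a smooth extension of the diffeomorphism. Invariance of
    [Omega] under [id + f] keeps the successive compositions where the estimates hold. *)
Lemma Diff_bd_extension Omega f : Diff_bd_sub_id Omega f ->
  exists U F, [/\ open U, Omega `<=` U, smooth_open U F,
    (forall x, Omega x -> f x = F x) & forall x, Omega x -> Omega (x + f x)].
Proof.
move=> [phi [[phib [U [g [oU OU gs phig]]] _] _] fphi].
exists U, (g + (-1) *: idfun); split; first exact: oU.
- exact: OU.
- exact: smooth_open_add oU gs (smooth_open_scale _ oU (@smooth_open_id U)).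
- move=> x Ox; rewrite (fphi x Ox) (phig x Ox) -(scaleN1r x); exact: erefl.
- move=> x Ox; rewrite fphi// addrC subrK.
  by case: phib => /(_ x Ox).
Qed.

End Extension.

Section Bounds.
Context {R : realType} {d : nat}.
Local Notation E := 'rV[R]_d.
Context (N : E -> R) (Omega : set E) (hN : is_norm N).
Implicit Types (f g psi F : E -> E) (U W : set E) (x y : E) (ys : seq E) (C : R).

Lemma normN0 : N 0 = 0.
Proof. by case: hN => _ NZ _; rewrite -(scale0r 0) NZ normr0 mul0r. Qed.

(** The triangle inequality gives [0 = N (x - x) <= N x + N x]. *)
Lemma normN_ge0 x : 0 <= N x.
Proof.
have [_ NZ ND] := hN; have := ND x (-1 *: x).
rewrite NZ normrN1 mul1r scaleN1r subrr normN0 -mulr2n.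
by rewrite pmulrn_lge0.
Qed.

Lemma normN_sum (I : Type) (r : seq I) (G : I -> E) :
  N (\sum_(i <- r) G i) <= \sum_(i <- r) N (G i).
Proof.
have [_ _ ND] := hN; elim: r => [|i r IH]; first by rewrite !big_nil normN0.
by rewrite !big_cons (le_trans (ND _ _))// lerD2l.
Qed.

Lemma prod_normN_ge0 ys : 0 <= \prod_(y <- ys) N y.
Proof. by apply: prodr_ge0 => y _; exact: normN_ge0. Qed.

(** An operator norm bound in homogeneous form, for arbitrary directions and with a real
    constant. *)
Definition deriv_bound F (n : nat) C : Prop := forall x ys, Omega x ->
  size ys = n -> N (iterD F ys x) <= C * \prod_(y <- ys) N y.

Lemma opnorm_le n (beta : n.-tuple E -> E) (C : R) :
  (forall ys : n.-tuple E, (forall i, N (tnth ys i) <= 1) -> N (beta ys) <= C) ->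
  (opnorm N beta <= C%:E)%E.
Proof.
move=> h; apply: ge_ereal_sup => _ [ys ys1 <-]; rewrite lee_fin; exact: h.
Qed.

Lemma prod_normN_le1 n (ys : n.-tuple E) : (forall i, N (tnth ys i) <= 1) ->
  \prod_(y <- ys) N y <= 1.
Proof.
move=> ys1; rewrite big_tuple; apply: prodr_ile1 => i _.
by rewrite normN_ge0 ys1.
Qed.

Lemma Cnorm_le U f F k C : dense_interior Omega ->
  open U -> Omega `<=` U -> smooth_open U F ->
  (forall y, Omega y -> f y = F y) -> 0 <= C ->
  (forall n, (n <= k)%N -> deriv_bound F n C) ->
  (Cnorm N Omega k f <= C%:E)%E.
Proof.
move=> dO oU OU Fs fF C0 FC; rewrite /Cnorm big_nat_cond.
apply: bigmax_le => [|i /andP[/andP[_ ik] _]].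
  apply: ge_ereal_sup => _ [x Ox <-]; rewrite lee_fin fF//.
  by have := FC 0%N isT x [::] Ox erefl; rewrite big_nil mulr1.
apply: ge_ereal_sup => _ [x Ox <-]; apply: opnorm_le => ys ys1.
rewrite (derivkE _ dO oU OU Fs fF Ox).
apply: le_trans (FC i ik x ys Ox (size_tuple ys)) _.
by rewrite ler_piMr// prod_normN_le1.
Qed.

(** By homogeneity each direction is scaled to norm at most 1, where the supremum applies; the
    factors taken out form the product of the norms. *)
Lemma deriv_bound_Cnorm U f F k n C : dense_interior Omega ->
  open U -> Omega `<=` U -> smooth_open U F ->
  (forall y, Omega y -> f y = F y) ->
  Cnorm N Omega k f = C%:E -> (n <= k)%N -> deriv_bound F n C.
Proof.
move=> dO oU OU Fs fF fC nk x ys Ox ysn; have [N0 NZ _] := hN.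
case: n ysn nk => [|n] ysn nk.
  rewrite (size0nil ysn) big_nil mulr1 /= -(fF x Ox) -lee_fin -fC.
  apply: le_trans (bigmax_ge_id _ _ _ _).
  by apply: ereal_sup_ubound; exists x.
(* A zero direction gives the pair of zeros, so the factorisation holds for it too. *)
pose ps := [seq (N y, (N y)^-1 *: y) | y <- ys].
have ysE : ys = [seq p.1 *: p.2 | p <- ps].
  rewrite -map_comp -[LHS]map_id; apply: eq_map => y /=.
  have [->|y0] := eqVneq y 0; first by rewrite normN0 scale0r.
  by rewrite scalerA divff ?scale1r//; apply: contra_neq y0; exact: N0.
have prodE : \prod_(y <- ys) N y = \prod_(p <- ps) p.1 by rewrite big_map.
rewrite {1}ysE (iterD_scale_dirs ps oU Fs (OU x Ox)) -prodE NZ.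
rewrite ger0_norm ?prod_normN_ge0// mulrC ler_wpM2r ?prod_normN_ge0//.
have zs_size : size [seq p.2 | p <- ps] == n.+1 by rewrite !size_map ysn.
rewrite -lee_fin -fC; pose zs := Tuple zs_size.
apply: le_trans (le_bigmax_seq _ n.+1 _ _ _ isT); last first.
  by rewrite mem_index_iota !ltnS leq0n.
apply: (@le_trans _ _ (opnorm N (@derivk R d Omega n.+1 f x))); last first.
  by apply: ereal_sup_ubound; exists x.
apply: ereal_sup_ubound; exists zs; last first.
  by rewrite (derivkE _ dO oU OU Fs fF Ox).
move=> i /=; rewrite (tnth_nth 0) /= -map_comp (nth_map 0); last first.
  by have := ltn_ord i; rewrite -{2}ysn.
rewrite /= NZ; set y := nth 0 ys i.
have [->|y0] := eqVneq y 0; first by rewrite normN0 mulr0.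
rewrite ger0_norm ?invr_ge0 ?normN_ge0// mulVf//.
by apply: contra_neq y0; exact: N0.
Qed.

End Bounds.

(** * Estimates for one composition step *)

Section CompositionBounds.
Context {R : realType} {d : nat}.
Local Notation E := 'rV[R]_d.
Context (N : E -> R) (Omega : set E) (hN : is_norm N).
Implicit Types (f g psi F : E -> E) (U W : set E) (x y : E) (ys : seq E).

(** The outer derivative has order [size bl], and its arguments are inner derivatives of orders
    [size b]. As the blocks together permute [ys], their products combine to the product over
    [ys]. *)
Lemma faa_term_bound F psi k (c : R) (a : nat -> R) ys bl x :
  (forall n, (n <= k)%N -> deriv_bound N Omega F n c) -> 0 <= c ->
  (forall n, 0 <= a n) ->
  (forall n, (0 < n <= size ys)%N -> deriv_bound N Omega psi n (a n)) ->
  (size ys <= k)%N -> bl \in faa_blocks ys -> Omega x -> Omega (psi x) ->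
  N (faa_term F psi bl x) <=
    c * (\prod_(n <- map size bl) a n) * \prod_(y <- ys) N y.
Proof.
move=> Fc c0 a0 psia ysk blys Ox Opx.
have blk : (size bl <= k)%N by exact: leq_trans (size_faa_blocks blys) ysk.
have sz : size [seq iterD psi b x | b <- bl] = size bl by rewrite size_map.
apply: le_trans (Fc _ blk (psi x) _ Opx sz) _.
rewrite -mulrA ler_wpM2l// !big_map.
have [bly _] := faa_blocks_spec blys; rewrite -(perm_big _ bly) big_flatten /=.
rewrite -big_split /= !big_seq; apply: ler_prod => b bbl.
rewrite normN_ge0//=; apply: psia => //; exact: size_faa_block blys bbl.
Qed.

(* The invariant of the induction on the number of composed maps; s is the sum
   of the norms of the perturbations composed so far. *)
Record near_id_bounds psi k (s : R) : Prop := NearIdBounds {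
  near_id_maps : forall x, Omega x -> Omega (psi x);
  near_id_order0 : forall x, Omega x -> N (psi x - x) <= s;
  near_id_order1 : forall x y, Omega x -> (0 < k)%N ->
    N ('D_y psi x) <= expR s * N y /\ N ('D_y psi x - y) <= s * expR s * N y;
  near_id_higher : forall n, (1 < n <= k)%N ->
    deriv_bound N Omega psi n ((Mcoef n)%:R * expR s ^+ n * s) }.

(** For [n >= 2] the factor [s] is absorbed by [s <= 1]; for [n = 1] this is the growth estimate of
    order one. *)
Lemma near_id_deriv_bound psi k s n : 0 <= s <= 1 -> near_id_bounds psi k s ->
  (0 < n <= k)%N -> deriv_bound N Omega psi n ((Mcoef n)%:R * expR s ^+ n).
Proof.
move=> /andP[s0 s1] [_ _ b1 bn] /andP[n0 nk] x ys Ox ysn.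
have [n1|n1] := leqP n 1.
  have n1E : n = 1%N by apply/eqP; rewrite eqn_leq n1.
  move: ysn; rewrite n1E; case: ys => [|y [|z ys]] // _.
  rewrite big_seq1 Mcoef1 mul1r expr1 /=.
  exact: (b1 x y Ox (leq_trans n0 nk)).1.
have nk' : (1 < n <= k)%N by rewrite n1.
apply: le_trans (bn n nk' x ys Ox ysn) _.
apply: ler_wpM2r; first exact: prod_normN_ge0.
by rewrite ler_piMr// mulr_ge0// exprn_ge0// expR_ge0.
Qed.

(** After division by [expR s ^+ n] the chain is s + cs + c <= (s + c)(1 + c) <= (s + c) e^c <= (s +
    c) e^(nc). *)
Lemma expR_step (s c : R) n : (0 < n)%N -> 0 <= s -> 0 <= c ->
  (s + c * s + c) * expR s ^+ n <= (s + c) * expR (s + c) ^+ n.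
Proof.
move=> n0 s0 c0; rewrite expRD exprMn mulrA [leRHS]mulrAC.
apply: ler_wpM2r; first by rewrite exprn_ge0// expR_ge0.
have e1 : 1 + c <= expR c := expR_ge1Dx c.
have e2 : expR c <= expR c ^+ n.
  by apply: ler_eXnr => //; apply: le_trans e1; rewrite lerDl.
apply: (@le_trans _ _ ((s + c) * (1 + c))).
  have -> : (s + c) * (1 + c) = s + c * s + c + c * c by ring.
  by rewrite lerDl mulr_ge0.
by apply: ler_wpM2l; [exact: addr_ge0|exact: le_trans e2].
Qed.

Lemma near_id_step psi F W U k (s c : R) :
  open W -> Omega `<=` W -> smooth_open W psi ->
  open U -> Omega `<=` U -> smooth_open U F ->
  0 <= s <= 1 -> 0 <= c -> near_id_bounds psi k s ->
  (forall x, Omega x -> Omega (x + F x)) ->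
  (forall n, (n <= k)%N -> deriv_bound N Omega F n c) ->
  (exists W', [/\ open W', Omega `<=` W' & smooth_open W' (psi + (F \o psi))]) /\
  near_id_bounds (psi + (F \o psi)) k (s + c).
Proof.
move=> oW OW psis oU OU Fs s01 c0 psib FO Fc.
have [s0 s1] := andP s01; have [_ _ ND] := hN.
(* The points that [psi] sends into the domain of [F]; all of [Omega] is among them because [psi]
   maps [Omega] to itself. *)
pose W' := W `&` psi @^-1` U.
have oW' : open W'.
  rewrite openE => x [Wx Ux]; apply: filterI; first exact: open_nbhs_nbhs.
  by apply: (psis [::] x Wx).1; exact: open_nbhs_nbhs.
have OW' : Omega `<=` W'.
  by move=> x Ox; split; [exact: OW|exact/OU/(near_id_maps psib)].
have psis' : smooth_open W' psi by apply: smooth_open_sub psis => x [].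
have W'U x : W' x -> U (psi x) by case.
have comps : smooth_open W' (F \o psi) := smooth_open_comp oW' oU psis' W'U Fs.
have iterE x ys : Omega x -> iterD (psi + (F \o psi)) ys x =
    iterD psi ys x + \sum_(bl <- faa_blocks ys) faa_term F psi bl x.
  move=> Ox; have W'x := OW' x Ox.
  rewrite -(iterD_comp ys oW' oU psis' W'U Fs W'x).
  exact: (iterD_add ys oW' psis' comps W'x).
split.
  exists W'; split; [exact: oW'|exact: OW'|].
  exact: smooth_open_add oW' psis' comps.
have e1c : expR s * (1 + c) <= expR (s + c).
  by rewrite expRD; apply: ler_wpM2l (expR_ge1Dx c); exact: expR_ge0.
split.
- by move=> x Ox; apply: FO; exact: near_id_maps psib _ Ox.
- move=> x Ox; have Opx := near_id_maps psib Ox.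
  rewrite -[(psi + _) x]/(psi x + F (psi x)) addrAC.
  apply: le_trans (ND _ _) _; apply: lerD; first exact: near_id_order0 psib _ Ox.
  by have := Fc 0%N (leq0n k) (psi x) [::] Opx erefl; rewrite big_nil mulr1.
- move=> x y Ox k0; have Opx := near_id_maps psib Ox.
  have [b1 b1'] := near_id_order1 psib y Ox k0.
  have FD : N ('D_('D_y psi x) F (psi x)) <= c * (expR s * N y).
    have := Fc 1%N k0 (psi x) [:: 'D_y psi x] Opx erefl; rewrite big_seq1.
    by move/le_trans; apply; apply: ler_wpM2l.
  have DE : 'D_y (psi + (F \o psi)) x = 'D_y psi x + 'D_('D_y psi x) F (psi x).
    have := iterE x [:: y] Ox.
    by rewrite /faa_blocks /= big_seq1.
  have Ny := normN_ge0 hN y.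
  rewrite DE; split.
    apply: le_trans (ND _ _) _; apply: le_trans (lerD b1 FD) _.
    rewrite mulrA -mulrDl; apply: ler_wpM2r => //.
    by rewrite -[X in X + _]mulr1 [c * _]mulrC -mulrDr.
  rewrite addrAC; apply: le_trans (ND _ _) _; apply: le_trans (lerD b1' FD) _.
  rewrite mulrA -!mulrDl; apply: ler_wpM2r => //.
  apply: ler_wpM2l; first exact: addr_ge0.
  by rewrite ler_expR lerDl.
- move=> n n1k x ys Ox ysn; have [n1 nk] := andP n1k; have Opx := near_id_maps psib Ox.
  have n0 : (0 < n)%N by exact: ltnW.
  have t0 : 0 <= expR s ^+ n by rewrite exprn_ge0// expR_ge0.
  (* The single block of size [n] takes the sharper bound, with the factor [s]; for smaller blocks
     this factor is dropped. *)
  pose a m := if m == n then (Mcoef n)%:R * expR s ^+ n * s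
    else (Mcoef m)%:R * expR s ^+ m.
  have a0 m : 0 <= a m.
    rewrite /a; case: ifP => _; first by rewrite mulr_ge0// mulr_ge0.
    by rewrite mulr_ge0// exprn_ge0// expR_ge0.
  have psia m : (0 < m <= size ys)%N -> deriv_bound N Omega psi m (a m).
    rewrite ysn => /andP[m0 mn]; rewrite /a; case: eqVneq => [->|_].
      exact: (near_id_higher psib n1k).
    have m0k : (0 < m <= k)%N by rewrite m0 (leq_trans mn nk).
    exact: (near_id_deriv_bound s01 psib m0k).
  have ysk : (size ys <= k)%N by rewrite ysn.
  rewrite iterE//; apply: le_trans (ND _ _) _.
  have bpsi : N (iterD psi ys x) <=
      (Mcoef n)%:R * expR s ^+ n * s * \prod_(y <- ys) N y.
    exact: (near_id_higher psib n1k Ox ysn).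
  have bsum : N (\sum_(bl <- faa_blocks ys) faa_term F psi bl x) <=
      c * ((Mcoef n)%:R * expR s ^+ n * s + (Mcoef n)%:R * expR s ^+ n) *
      \prod_(y <- ys) N y.
    apply: le_trans (normN_sum hN _ _) _.
    have ys1 : (1 < size ys)%N by rewrite ysn.
    have := sum_faa_blocks_Mcoef ((Mcoef n)%:R * expR s ^+ n * s) (expR s) ys1.
    rewrite ysn => <-; rewrite mulr_sumr mulr_suml [leLHS]big_seq [leRHS]big_seq.
    apply: ler_sum => bl blys.
    exact: (faa_term_bound Fc c0 a0 psia ysk blys Ox Opx).
  apply: le_trans (lerD bpsi bsum) _; rewrite -mulrDl.
  apply: ler_wpM2r; first exact: prod_normN_ge0.
  have -> : (Mcoef n)%:R * expR s ^+ n * s +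
      c * ((Mcoef n)%:R * expR s ^+ n * s + (Mcoef n)%:R * expR s ^+ n) =
    (Mcoef n)%:R * ((s + c * s + c) * expR s ^+ n) by ring.
  rewrite -mulrA; apply: ler_wpM2l => //; rewrite [leRHS]mulrC.
  exact: expR_step.
Qed.

End CompositionBounds.

(** * Iterating the composition *)

Section IteratedComposition.
Context {R : realType} {d : nat}.
Local Notation E := 'rV[R]_d.
Context (N : E -> R) (Omega : set E) (hN : is_norm N).

Lemma near_id_idfun k : near_id_bounds N Omega idfun k 0.
Proof.
split.
- by [].
- by move=> x _; rewrite subrr normN0.
- move=> x y _ _; rewrite derive_id expR0 mul1r subrr normN0// !mul0r.
  by split.
- move=> n /andP[n1 _] x ys _ ysn; rewrite mulr0 mul0r iterD_id.
  by case: ys ysn n1 => [|y [|z ys]] => [<-|<-|] //; rewrite normN0.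
Qed.

(** Orders 0 and 1 use the estimates for the difference from the identity; from order 2 on the
    derivatives of the identity vanish. Monotonicity of [Mcoef] and of the powers of [expR s] gives
    one constant for all [n <= k], as the maximum in [Cnorm] needs. *)
Lemma near_id_deriv_bound_sub psi W k (s : R) n : open W -> Omega `<=` W ->
  smooth_open W psi -> 0 <= s -> near_id_bounds N Omega psi k s -> (n <= k)%N ->
  deriv_bound N Omega (psi + (-1) *: idfun) n ((Mcoef k)%:R * expR s ^+ k * s).
Proof.
move=> oW OW psis s0 psib nk x ys Ox ysn.
have es1 : 1 <= expR s by rewrite -expR0 ler_expR.
have Mle : (Mcoef n)%:R * expR s ^+ n * s <= (Mcoef k)%:R * expR s ^+ k * s.
  apply: ler_wpM2r => //; apply: ler_pM => //.
  - by rewrite ler_nat Mcoef_leq.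
  - exact: ler_weXn2l.
suff bn : N (iterD (psi + (-1) *: idfun) ys x) <=
    (Mcoef n)%:R * expR s ^+ n * s * \prod_(y <- ys) N y.
  by apply: le_trans bn _; apply: ler_wpM2r => //; exact: prod_normN_ge0.
have ids := @smooth_open_id R d W; have Wx := OW x Ox.
rewrite (iterD_add ys oW psis (smooth_open_scale (-1) oW ids) Wx).
rewrite (iterD_scale (-1) ys oW ids Wx) iterD_id scaleN1r.
have [n1|n1] := leqP n 1; last first.
  have n1k : (1 < n <= k)%N by rewrite n1.
  have := near_id_higher psib n1k Ox ysn.
  by case: ys ysn => [|y [|z ys]] ysn; rewrite -?ysn in n1 => //; rewrite oppr0 addr0.
case: ys ysn => [|y [|z ys]] ysn; rewrite -?ysn in n1 nk * => //.
  rewrite big_nil Mcoef0 mul1r expr0 mul1r mulr1.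
  exact: (near_id_order0 psib Ox).
rewrite big_seq1 Mcoef1 mul1r expr1 [expR s * s]mulrC.
exact: (near_id_order1 psib y Ox nk).2.
Qed.

(** The induction removes the map composed last; partial sums stay at most 1 because the [c j] are
    nonnegative. The map [psi], smooth near [Omega], represents the composition on [Omega]. *)
Lemma near_id_comp k L (f : 'I_L -> E -> E) (c : 'I_L -> R) (r : seq 'I_L) :
  dense_interior Omega ->
  (forall j, Diff_bd_sub_id Omega (f j)) ->
  (forall j, 0 <= c j) -> (forall j, Cnorm N Omega k (f j) = (c j)%:E) ->
  \sum_(j <- r) c j <= 1 ->
  exists W psi, [/\ open W, Omega `<=` W, smooth_open W psi,
    forall x, Omega x ->
      foldl (fun g i => (idfun \+ f i) \o g) idfun r x = psi x &
    near_id_bounds N Omega psi k (\sum_(j <- r) c j)].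
Proof.
move=> dO fD c0 fc; elim/last_ind: r => [|r j IH].
  move=> _; exists setT, idfun; split.
  - exact: openT.
  - by [].
  - exact: smooth_open_id.
  - by [].
  - by rewrite big_nil; exact: near_id_idfun.
rewrite -cats1 big_cat big_seq1 /= => rj1.
have r1 : \sum_(j <- r) c j <= 1 by apply: le_trans rj1; rewrite lerDl.
have r01 : 0 <= \sum_(j <- r) c j <= 1 by rewrite r1 sumr_ge0.
have [W [psi [oW OW psis psiE psib]]] := IH r1.
have [U [F [oU OU Fs fF fO]]] := Diff_bd_extension (fD j).
have FO x : Omega x -> Omega (x + F x) by move=> Ox; rewrite -(fF x Ox); exact: fO.
have Fc n : (n <= k)%N -> deriv_bound N Omega F n (c j).
  exact: (deriv_bound_Cnorm hN dO oU OU Fs fF (fc j)).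
have [[W' [oW' OW' psis']] psib'] :=
  near_id_step hN oW OW psis oU OU Fs r01 (c0 j) psib FO Fc.
exists W', (psi + (F \o psi)); split; [exact: oW'|exact: OW'|exact: psis'| |].
  move=> x Ox; rewrite foldl_cat /= (psiE x Ox).
  by rewrite (fF _ (near_id_maps psib Ox)).
exact: psib'.
Qed.

End IteratedComposition.

(** * The estimate for the extended real norms *)

Local Open Scope ereal_scope.

Lemma Cnorm_set0 (R : realType) (d : nat) (N : 'rV[R]_d -> R) k f :
  Cnorm N set0 k f = -oo.
Proof.
rewrite /Cnorm; apply/eqP; rewrite -leeNy_eq; apply: bigmax_le => [|i _].
  by rewrite /supnorm image_set0 ereal_sup0.
by rewrite /supopnorm image_set0 ereal_sup0.
Qed.

Lemma Cnorm_ge0 (R : realType) (d : nat) (N : 'rV[R]_d -> R) Omega k f :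
  is_norm N -> Omega !=set0 -> 0 <= Cnorm N Omega k f.
Proof.
move=> hN [x Ox]; apply: le_trans (bigmax_ge_id _ _ _ _).
apply: (@le_trans _ _ (N (f x))%:E); first by rewrite lee_fin normN_ge0.
by apply: ereal_sup_ubound; exists x.
Qed.

Theorem proposition4p1 (R : realType) (d : nat) (hd : (0 < d)%N)
    (Omega : set 'rV[R]_d) (hcomp : compact Omega) (hconv : convex_set Omega)
    (hint : dense_interior Omega)
    (N : 'rV[R]_d -> R) (hN : is_norm N)
    (k L : nat) (hL : (0 < L)%N) (f : 'I_L -> 'rV[R]_d -> 'rV[R]_d)
    (hf : forall j, Diff_bd_sub_id Omega (f j))
    (hsum : \sum_(j < L) Cnorm N Omega k (f j) <= 1) :
  Cnorm N Omega k (comp_id_add f \- idfun)%R <=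
    (Mcoef k)%:R%:E * expeR (k%:R%:E * \sum_(j < L) Cnorm N Omega k (f j))
      * \sum_(j < L) Cnorm N Omega k (f j)
  /\
  Cnorm N Omega k (comp_id_add f \- idfun)%R <=
    (Mcoef k)%:R%:E * expeR k%:R%:E * \sum_(j < L) Cnorm N Omega k (f j).
Proof.
(* For empty [Omega] the norm on the left is a supremum over nothing, that is [-oo]. *)
have [->|/set0P On0] := eqVneq Omega set0.
  by rewrite Cnorm_set0; split; exact: leNye.
have f0 j : 0 <= Cnorm N Omega k (f j) by exact: Cnorm_ge0.
(* Each norm is at most the whole sum, hence at most 1, so the estimate can be carried out in real
   numbers. *)
have f_fin j : Cnorm N Omega k (f j) \is a fin_num.
  rewrite ge0_fin_numE//; apply: le_lt_trans (ltry 1%R); apply: le_trans hsum.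
  by rewrite (bigD1 j)//= leeDl// sume_ge0.
pose c j := fine (Cnorm N Omega k (f j)).
have fc j : Cnorm N Omega k (f j) = (c j)%:E by rewrite fineK.
have c0 j : (0 <= c j)%R by rewrite fine_ge0.
have sumE : \sum_(j < L) Cnorm N Omega k (f j) = (\sum_(j < L) c j)%:E.
  by rewrite -sumEFin; apply: eq_bigr.
move: hsum; rewrite !sumE lee_fin => c1.
have enumE : (\sum_(j <- enum 'I_L) c j = \sum_(j < L) c j)%R by rewrite big_enum.
have s0 : (0 <= \sum_(j < L) c j)%R by exact: sumr_ge0.
have enum1 : (\sum_(j <- enum 'I_L) c j <= 1)%R by rewrite enumE.
have [W [psi [oW OW psis psiE psib]]] := near_id_comp hN hint hf c0 fc enum1.
rewrite enumE in psib; move: psib s0 c1; set s := (\sum_(j < L) c j)%R => psib s0 c1.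
have bound : Cnorm N Omega k (comp_id_add f \- idfun)%R <=
    ((Mcoef k)%:R * expR s ^+ k * s)%:E.
  have ids := smooth_open_scale (-1)%R oW (@smooth_open_id R d W).
  apply: (Cnorm_le hN hint oW OW (smooth_open_add oW psis ids)).
  - by move=> x Ox; rewrite /= /comp_id_add (psiE x Ox) -scaleN1r.
  - by rewrite !mulr_ge0// exprn_ge0// expR_ge0.
  - by move=> n nk; exact: (near_id_deriv_bound_sub hN oW OW psis s0 psib nk).
have E1 : (expR s ^+ k = expR (k%:R * s))%R by rewrite expRM_natl.
rewrite E1 in bound; split; first by [].
(* The second estimate follows from the first, since [s <= 1] bounds the exponent by [k]. *)
apply: le_trans bound _; rewrite /= lee_fin; apply: ler_wpM2r => //.
by apply: ler_wpM2l => //; rewrite ler_expR ler_piMr.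
Qed.
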